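(* Let $d\ge1$ and let $U:\mathbb{R}^d\to\mathbb{R}$ be of class $\mathcal C^3$ with $\int_{\mathbb{R}^d}e^{-U(x)}\,dx<\infty$, such that $\lim_{|x|\to\infty}U(x)=\infty$ and $U$ has a nondegenerate local minimum (a local minimum at which the Hessian of $U$ is positive definite). Then the equivalence relation $\sim$ on $E$ has only one equivalence class. In particular, $(x,\theta)\leadsto(y,\eta)$ for all $(x,\theta)\in E$ and $(y,\eta)\in E$.
   Context: Setting. $E=\mathbb{R}^d\times\{-1,1\}^d$. For $i=1,\dots,d$, $F_i$ flips the sign of the $i$-th component of $\theta\in\{-1,1\}^d$; for a tuple $I=(i_1,\dots,i_k)$, $F_I\theta=F_{i_1}\cdots F_{i_k}\theta$. Write $(a)_+=\max(0,a)$. Switching intensities are continuous functions $\lambda_i:E\to[0,\infty)$ with $\lambda_i(x,\theta)-\lambda_i(x,F_i\theta)=\theta_i\partial_iU(x)$; equivalently $\lambda_i=(\theta_i\partial_iU)_++\gamma_i$ with continuous $\gamma_i\ge0$, $\gamma_i(x,F_i\theta)=\gamma_i(x,\theta)$. The choice $\gamma\equiv0$ (canonical switching intensities) is allowed. Control sequences. A control sequence is a pair $\mathbf u=(\mathbf t,\mathbf i)$ with $\mathbf t=(t_0,\dots,t_m)\in(0,\infty)^{m+1}$ and $\mathbf i=(i_1,\dots,i_m)\in\{1,\dots,d\}^m$, $m\ge0$ an integer. Put $\tau_k=\sum_{j=0}^{k-1}t_j$, $\tau_0=0$. From $(x,\theta)$ it generates the trajectory $\theta(t)=F_{(i_1,\dots,i_k)}\theta$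 for $\tau_k\le t<\tau_{k+1}$, $0\le k\le m$, and $x(t)=x+\int_0^t\theta(s)\,ds$, with final point $\Phi_{\mathbf u}(x,\theta)=(x(\tau_{m+1}),F_{(i_1,\dots,i_m)}\theta)$. It is admissible from $(x,\theta)$ if, for every $k\in\{1,\dots,m\}$, $\lambda_{i_k}(x(\tau_k),F_{(i_1,\dots,i_{k-1})}\theta)>0$, i.e. component $i_k$ has positive switching rate just before it is flipped. $(x,\theta)\leadsto(x',\theta')$ means that there is a control sequence $\mathbf u$ admissible from $(x,\theta)$ with $\Phi_{\mathbf u}(x,\theta)=(x',\theta')$. $(x,\theta)\sim(x',\theta')$ means that the two points are equal or $(x,\theta)\leadsto(x',\theta')\leadsto(x,\theta)$. *)

(* Defs.v *)
From HB Require Import structures.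
From mathcomp Require Import all_boot all_order all_algebra.
From mathcomp Require Import all_classical all_reals all_analysis.

Set Implicit Arguments.
Unset Strict Implicit.
Unset Printing Implicit Defensive.

Import Order.TTheory GRing.Theory Num.Theory.
Import numFieldNormedType.Exports.

Local Open Scope classical_set_scope.
Local Open Scope ring_scope.

Section lebesgue_tuple.
Context (R : realType).
Local Open Scope ereal_scope.

Definition tcons n (p : R * n.-tuple R) : n.+1.-tuple R :=
  [tuple of p.1 :: p.2].

Lemma measurable_tcons n : measurable_fun [set: R * n.-tuple R] (@tcons n).
Proof. exact: measurable_cons. Qed.

Section lebesgue_cons.
Variables (n : nat) (mu : {sigma_finite_measure set (n.-tuple R) -> \bar R}).

Definition lebesgue_cons : set (n.+1.-tuple R) -> \bar R :=
  pushforward (@lebesgue_measure R \x mu) (@tcons n).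

Let lebesgue_cons0 : lebesgue_cons set0 = 0.
Proof. by rewrite /lebesgue_cons /pushforward preimage_set0 measure0. Qed.

Let lebesgue_cons_ge0 A : 0 <= lebesgue_cons A.
Proof. by rewrite /lebesgue_cons /pushforward; exact: measure_ge0. Qed.

Let lebesgue_cons_sigma_additive : semi_sigma_additive lebesgue_cons.
Proof.
move=> F mF tF mUF; rewrite /lebesgue_cons /pushforward preimage_bigcup.
apply: measure_semi_sigma_additive.
- by move=> k; rewrite -[X in measurable X]setTI; exact: measurable_tcons.
- apply/trivIsetP => /= i j _ _ ij; rewrite -preimage_setI.
  by move/trivIsetP : tF => /(_ _ _ _ _ ij) ->//; rewrite preimage_set0.
- by rewrite -preimage_bigcup -[X in measurable X]setTI; exact: measurable_tcons.
Qed.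

HB.instance Definition _ := isMeasure.Build _ _ _ lebesgue_cons
  lebesgue_cons0 lebesgue_cons_ge0 lebesgue_cons_sigma_additive.

Let lebesgue_cons_sigma_finite : sigma_finite setT lebesgue_cons.
Proof.
have /sigma_finiteP[F [TF ndF Foo]] := sigma_finiteT (@lebesgue_measure R).
have /sigma_finiteP[G [TG ndG Goo]] := sigma_finiteT mu.
pose uncons (t : n.+1.-tuple R) : R * n.-tuple R :=
  (thead t, [tuple of behead t]).
have unconsK : cancel (@tcons n) uncons.
  by case=> x t; congr pair => //; exact: val_inj.
have muncons : measurable_fun setT uncons.
  apply: measurable_fun_pair; first exact: measurable_tnth.
  exact: measurable_behead.
exists (fun k => uncons @^-1` (F k `*` G k)).
  apply/seteqP; split=> // t _.
  have [i _ Fi] : (\bigcup_k F k) (uncons t).1 by rewrite -TF.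
  have [j _ Gj] : (\bigcup_k G k) (uncons t).2 by rewrite -TG.
  exists (maxn i j) => //; split.
    by apply: subsetPset Fi; exact/ndF/leq_maxl.
  by apply: subsetPset Gj; exact/ndG/leq_maxr.
move=> k; have [mF Fk] := Foo k; have [mG Gk] := Goo k.
have mFG : measurable (F k `*` G k) by exact: measurableX.
split; first by rewrite -[X in measurable X]setTI; exact: muncons.
rewrite /lebesgue_cons /pushforward -comp_preimage.
rewrite (_ : uncons \o _ = id); last exact/funext.
by rewrite preimage_id product_measure1E// lte_mul_pinfty// ge0_fin_numE.
Qed.

HB.instance Definition _ := Measure_isSigmaFinite.Build _ _ _ lebesgue_cons
  lebesgue_cons_sigma_finite.

End lebesgue_cons.

(* Lebesgue measure on R^n, as the n-fold product of the one-dimensional one. *)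
Fixpoint lebesgue_tuple n : {sigma_finite_measure set (n.-tuple R) -> \bar R} :=
  if n is k.+1 then lebesgue_cons (lebesgue_tuple k) else \d_ [tuple].

Lemma lebesgue_tuple_box n (a b : n.-tuple R) :
  (forall i, tnth a i <= tnth b i)%R ->
  lebesgue_tuple n [set t | forall i, (tnth a i <= tnth t i <= tnth b i)%R] =
  (\prod_i (tnth b i - tnth a i))%:E.
Proof.
have mbox m (p q : m.-tuple R) : measurable
    [set t : m.-tuple R | forall i, (tnth p i <= tnth t i <= tnth q i)%R].
  rewrite (_ : [set t | _] = \bigcap_(i in [set: 'I_m])
      ((@tnth _ _)^~ i @^-1` `[tnth p i, tnth q i])); last first.
    apply/seteqP; split => t /= H i; last by have := H i I; rewrite /= in_itv.
    by move=> _ /=; rewrite in_itv /=.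
  apply: fin_bigcap_measurable => // i _; rewrite -[X in measurable X]setTI.
  exact: measurable_tnth.
elim: n a b => [|n IH] a b ab.
  by rewrite big_ord0 /= diracE mem_set// => -[].
case: (tupleP a) ab => a0 {}a; case: (tupleP b) => b0 {}b ab.
have ab0 : (a0 <= b0)%R by exact: (ab ord0).
have {}ab i : (tnth a i <= tnth b i)%R by have := ab (lift ord0 i); rewrite !tnthS.
rewrite /= /lebesgue_cons /pushforward.
rewrite (_ : _ @^-1` _ = `[a0, b0] `*`
    [set t | forall i, (tnth a i <= tnth t i <= tnth b i)%R]); last first.
  apply/seteqP; split => -[x t] /=.
    move=> H; split; first by have := H ord0; rewrite in_itv.
    by move=> i; have := H (lift ord0 i); rewrite !tnthS.
  case; rewrite in_itv /= => H0 H i.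
  by case: (unliftP ord0 i) => [j|] ->; rewrite ?tnthS.
have mab0 : lebesgue_measure (`[a0, b0]%classic : set R) = (b0 - a0)%:E.
  rewrite lebesgue_measure_itv /= lte_fin.
  by move: ab0; rewrite le_eqVlt => /orP[/eqP->|->]; rewrite ?ltxx ?subrr ?EFinB.
rewrite product_measure1E //; last exact: mbox.
rewrite IH // big_ord_recl /= EFinM -mab0; congr (_ * _).
by congr EFin; apply: eq_bigr => i _; rewrite !tnthS.
Qed.

End lebesgue_tuple.

Section calculus.
Context (R : realType) (d : nat).
Implicit Types U : 'rV[R]_d -> R.

Definition partial (i : 'I_d) U : 'rV[R]_d -> R := 'D_'e_i U.

Fixpoint class_C (k : nat) U : Prop :=
  continuous U /\
  if k is k'.+1 then
    forall i, (forall x, derivable U x 'e_i) /\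
              class_C k' (partial i U)
  else True.

Definition hessian U (x : 'rV[R]_d) : 'M[R]_d :=
  \matrix_(i, j) partial i (partial j U) x.

Definition posdefmx (H : 'M[R]_d) : Prop :=
  forall v : 'rV[R]_d, v != 0 -> 0 < (v *m H *m v^T) 0 0.

Definition nondegenerate_local_min U (x : 'rV[R]_d) : Prop :=
  (\forall y \near x, U x <= U y) /\ posdefmx (hessian U x).

(* The norm on 'rV[R]_d is the sup norm; the filter |x| -> oo is the same for
   all norms. *)
Definition coercive U : Prop :=
  forall M : R, \forall r \near +oo, forall x : 'rV[R]_d, r <= `|x| -> M <= U x.

Definition integrable_exp U : Prop :=
  (\int[lebesgue_tuple R d]_t (expR (- U (\row_i tnth t i)))%:E < +oo)%E.

End calculus.

(* A velocity theta in {-1,1}^d is encoded by sign bits: true stands for -1. *)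
Notation phase R d := ('rV[R]_d * 'rV[bool]_d)%type.

Section zigzag.
Context (R : realType) (d : nat).
Implicit Types (x : 'rV[R]_d) (theta : 'rV[bool]_d) (z : phase R d).

Definition velocity theta : 'rV[R]_d := \row_i (-1) ^+ theta 0 i.

Definition flip (i : 'I_d) theta : 'rV[bool]_d :=
  \row_j (if j == i then ~~ theta 0 j else theta 0 j).

Definition flips (I : seq 'I_d) theta : 'rV[bool]_d := foldr flip theta I.

(* bool is discrete, so the topology on phase R d is the usual one on E. *)
Definition switching_intensities (U : 'rV[R]_d -> R)
    (lambda : 'I_d -> phase R d -> R) : Prop :=
  forall i,
    [/\ continuous (lambda i),
        forall z, 0 <= lambda i z
      & forall x theta, lambda i (x, theta) - lambda i (x, flip i theta) =
          velocity theta 0 i * partial i U x].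

Record control := Control {
  nb_flips : nat;
  durations : nb_flips.+1.-tuple R;
  flipped : nb_flips.-tuple 'I_d;
  durations_gt0 : forall k, 0 < tnth durations k }.

Implicit Type u : control.

Definition tau u (k : nat) : R := \sum_(j < k) (durations u)`_j.

(* For tau_k <= t < tau_(k+1), k <= m, the flips done by time t are the first
   k ones. *)
Definition traj_theta u theta (t : R) : 'rV[bool]_d :=
  flips (take (count (fun k => tau u k <= t) (iota 1 (nb_flips u))) (flipped u))
    theta.

Definition traj_x u x theta (t : R) : 'rV[R]_d :=
  x + \row_i \int[lebesgue_measure]_(s in `[0, t])
        velocity (traj_theta u theta s) 0 i.

Definition endpoint u z : phase R d :=
  (traj_x u z.1 z.2 (tau u (nb_flips u).+1), flips (flipped u) z.2).

(* With flips indexed from 0, the k-th one occurs at time tau_(k+1). *)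
Definition admissible (lambda : 'I_d -> phase R d -> R) u z : Prop :=
  forall k : 'I_(nb_flips u),
    0 < lambda (tnth (flipped u) k)
          (traj_x u z.1 z.2 (tau u k.+1), flips (take k (flipped u)) z.2).

Definition leadsto (lambda : 'I_d -> phase R d -> R) z z' : Prop :=
  exists u, admissible lambda u z /\ endpoint u z = z'.

Definition communicate (lambda : 'I_d -> phase R d -> R) z z' : Prop :=
  z = z' \/ (leadsto lambda z z' /\ leadsto lambda z' z).

Definition commclass (lambda : 'I_d -> phase R d -> R) z : set (phase R d) :=
  [set z' | communicate lambda z z'].

End zigzag.

(* Main.v *)
Require Import Defs.
From mathcomp Require Import all_boot all_order all_algebra.
From mathcomp Require Import all_classical all_reals all_analysis.
From mathcomp Require Import ring lra.
Set Implicit Arguments.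
Unset Strict Implicit.
Unset Printing Implicit Defensive.
Import Order.TTheory GRing.Theory Num.Theory.
Import numFieldNormedType.Exports.
Local Open Scope classical_set_scope.
Local Open Scope ring_scope.

(** Component [i] may be flipped at [(x, eta)] as soon as
    [eta_i * d_i U x > 0], because the two intensities of [i] there are
    nonnegative and differ by this number ([uphill_intensity_gt0]). It is enough
    to connect all phases with such uphill flips alone. The system that uses
    only them is invariant under reversal of time together with negation of the
    velocity ([reach_turn]).

    A family [S] of sets of positions, one for each velocity, is called
    [forward] when neither motion nor uphill flips leave it; the phases
    reachable from a given one are the basic example. Three facts about forward
    sets carry the proof.

    - Coercivity. In a nonempty forward set each component can be flipped
      somewhere ([exists_uphill]): otherwise that component would keep a
      constant sign, and a minimiser of [U] tilted along this coordinate could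
      be improved by moving on. Using such flips one coordinate at a time, the
      set is seen to have an interior point ([forward_interior]).

    - Conservation. Every density that is a nonincreasing function of [U] is
      stationary for the process with the uphill intensities. A closed forward
      set loses no mass, so it gains none either: all inward fluxes vanish,
      through flips and through motion, and the interior of the set is stable
      under backward motion and backward flips as well
      ([closed_forward_interior_reversible]). With the compactly supported
      density [max(0, M - U)^2], all integrals can be replaced by finite sums
      over a fine grid, with an error that is negligible against the number of
      grid points ([balance]).

    - Connectedness. A nonempty open set that is stable under motion and flips
      in both directions of time is the whole phase space
      ([reversible_open_full]): the complement of its union with the interior
      of its complement is stable too, and has no interior point, hence is
      empty.

    Consequently the closure of a nonempty forward set is everything
    ([closure_forward_full]). Given two phases [z] and [z'], the phases
    reachable from [z] are dense, and those reachable from [z'] with its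
    velocity negated contain an open set; the two meet after a negation of
    velocities, and reversing the second path leads from [z] to [z']. *)

(** * Norms, compactness and first-order expansion *)

Section analysis.
Context (R : realType) (d : nat).
Implicit Types (x y : 'rV[R]_d).

Lemma norm_coord x i : `|x 0 i| <= `|x|.
Proof.
rewrite [`|x|]mx_normrE; apply: le_trans (le_bigmax _ _ (0, i)) => //=.
Qed.

Lemma norm_le x (c : R) : 0 <= c -> (forall i, `|x 0 i| <= c) -> `|x| <= c.
Proof.
move=> c0 xc; rewrite [`|x|]mx_normrE; apply: bigmax_le => // -[i j] _ /=.
by rewrite ord1.
Qed.

Lemma bounded_ball_compact (r : R) : compact [set x : 'rV[R]_d | `|x| <= r].
Proof.
apply: bounded_closed_compact.
  exists r; split; first exact: num_real.
  by move=> M rM x /= xr; exact/ltW/(le_lt_trans xr).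
apply: (@closed_comp _ _ (fun x : 'rV[R]_d => `|x|) [set t | t <= r]).
  by move=> x _; exact: norm_continuous.
exact: closed_le.
Qed.

Lemma compact_uniform (f : 'rV[R]_d -> R) (r e : R) : continuous f -> 0 < e ->
  exists2 del, 0 < del & forall x y, `|x| <= r -> `|y - x| <= del ->
    `|f y - f x| <= e.
Proof.
move=> cf e0.
have cov := (compact_near_coveringP _).1 (@bounded_ball_compact r).
pose P (del : R) (x : 'rV[R]_d) := forall y, `|y - x| <= del -> `|f y - f x| <= e.
have [x _|del /= del0 H] := cov R (0 : R)^'+ P _.
  have e20 : 0 < e / 2 by rewrite divr_gt0.
  have /nbhs_ballP[a /= a0 Ha] : \forall y \near x, `|f x - f y| < e / 2.
    by have /cvgrPdist_lt := cf x; exact.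
  have a20 : 0 < a / 2 by rewrite divr_gt0.
  exists (ball x (a / 2), [set t | t < a / 2]) => /=.
    split; first exact: nbhsx_ballx.
    by near=> t; near: t; exact: nbhs_right_lt.
  move=> [z t] /= [xz ta] y yz.
  have Hz : `|f x - f z| < e / 2.
    apply: Ha; apply: le_ball xz; lra.
  have Hy : `|f x - f y| < e / 2.
    apply: Ha; rewrite mx_norm_ball /ball_ /= in xz *.
    have -> : x - y = (x - z) - (y - z) by rewrite opprB addrA subrK.
    apply: le_lt_trans (ler_normB _ _) _; lra.
  have -> : f y - f z = (f x - f z) - (f x - f y) by ring.
  apply: le_trans (ler_normB _ _) _; lra.
exists (del / 2); first by rewrite divr_gt0.
move=> x y xr; apply: (H (del / 2)) => //=; rewrite ?divr_gt0//.
rewrite sub0r normrN ger0_norm ?divr_ge0 ?ltW//; lra.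
Unshelve. all: by end_near. Qed.

Lemma compact_bound (f : 'rV[R]_d -> R) (r : R) : continuous f ->
  exists B, forall x, `|x| <= r -> `|f x| <= B.
Proof.
move=> cf; have [r0|r0] := leP 0 r; last first.
  by exists 0 => x xr; have := normr_ge0 x; lra.
have [|||c _ H] := @compact_EVT_max _ R (fun x => `|f x|) [set x : 'rV[R]_d | `|x| <= r].
- by exists 0 => /=; rewrite normr0.
- exact: bounded_ball_compact.
- apply: continuous_subspaceT => x; apply: continuous_comp; first exact: cf.
  exact: norm_continuous.
by exists `|f c| => x xr; apply: H; rewrite inE.
Qed.

Lemma mvt_error (f df : R -> R) (c e a : R) :
  (forall t : R, is_derive t 1 f (df t)) ->
  (forall t, `|t| <= `|a| -> `|df t - c| <= e) ->
  `|f a - f 0 - a * c| <= e * `|a|.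
Proof.
move=> fd dfc.
have cf A : {within A, continuous f}.
  apply: continuous_subspaceT => t.
  have [dft _] := fd t.
  exact/differentiable_continuous/derivable1_diffP.
have [a0|/ltW a0] := leP 0 a.
  have [t] := MVT_segment a0 (fun t _ => fd t) (cf _).
  rewrite in_itv /= => /andP[t0 ta] ->; rewrite subr0.
  have -> : df t * a - a * c = (df t - c) * a by ring.
  rewrite normrM ler_wpM2r//; apply: dfc.
  by rewrite !ger0_norm.
have [t] := MVT_segment a0 (fun t _ => fd t) (cf _).
rewrite in_itv /= => /andP[t0 ta] E.
have -> : f a - f 0 - a * c = (df t - c) * a.
  have -> : f a - f 0 = - (f 0 - f a) by ring.
  rewrite E; ring.
rewrite normrM ler_wpM2r//; apply: dfc.
by rewrite !ler0_norm// lerN2.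
Qed.

Lemma is_derive_line (U : 'rV[R]_d -> R) i x (t : R) :
  (forall x, derivable U x 'e_i) ->
  is_derive t 1 (fun s => U (x + s *: 'e_i)) (partial i U (x + t *: 'e_i)).
Proof.
move=> dU.
have E : (fun h : R => h^-1 *: (((fun s => U (x + s *: 'e_i)) \o shift t) (h *: 1) -
    U (x + t *: 'e_i))) = (fun h : R => h^-1 *:
    ((U \o shift (x + t *: 'e_i)) (h *: 'e_i) - U (x + t *: 'e_i))).
  apply/funext => h /=; congr (_ *: (U _ - _)).
  by rewrite (_ : h *: 1 = h) ?scalerDl 1?addrCA//; exact: mulr1.
by split; [rewrite /derivable E; exact: dU|rewrite /derive E].
Qed.

End analysis.

Section first_order.
Context (R : realType) (d : nat) (U : 'rV[R]_d -> R).
Hypothesis dU : forall i x, derivable U x 'e_i.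
Hypothesis cdU : forall i, continuous (partial i U).

(** The derivative of [U] at [x] in the direction [v]. *)
Definition slope (v x : 'rV[R]_d) : R := \sum_i v 0 i * partial i U x.

(** Continuous partial derivatives give a total derivative, uniformly on
    bounded sets: [x] is joined to [x + s *: v] by changing the coordinates one
    after the other, and the mean value theorem is used on each segment. *)
Lemma first_order (r e : R) : 0 < e ->
  exists2 del, 0 < del & forall (v x : 'rV[R]_d) (s : R), `|v| <= 1 ->
    `|x| <= r -> `|s| <= del ->
    `|U (x + s *: v) - U x - s * slope v x| <= e * `|s|.
Proof.
move=> e0.
pose e' := e / d.+1%:R.
have e'0 : 0 < e' by rewrite divr_gt0.
have [D D0 HD] : exists2 D : 'I_d -> R, (forall i, 0 < D i) &
   forall i x y, `|x| <= r -> `|y - x| <= D i ->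
     `|partial i U y - partial i U x| <= e'.
  have /choice[D HD] : forall i : 'I_d, exists D : R, 0 < D /\
     forall x y, `|x| <= r -> `|y - x| <= D ->
     `|partial i U y - partial i U x| <= e'.
    by move=> i; have [D D0 HD] := compact_uniform r (@cdU i) e'0; exists D.
  by exists D => i; case: (HD i).
pose del := \big[Order.min/1]_i D i.
have del0 : 0 < del by apply: lt_bigmin.
exists del => // v x s v1 xr sdel.
pose mid k : 'rV[R]_d := x + \row_j (if (j < k)%N then s * v 0 j else 0).
have midd : mid d = x + s *: v.
  by congr (_ + _); apply/rowP => j; rewrite !mxE ltn_ord.
have mid0 : mid 0%N = x.
  by rewrite /mid (_ : \row_j _ = 0) ?addr0//; apply/rowP => j; rewrite !mxE.
have midS (k : 'I_d) : mid k.+1 = mid k + (s * v 0 k) *: 'e_k.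
  rewrite /mid -addrA; congr (_ + _); apply/rowP => j; rewrite !mxE eqxx /=.
  rewrite ltnS; have [jk|jk|/val_inj->] := ltngtP j k.
  - by rewrite (_ : (j == k) = false) ?mulr0 ?addr0// -val_eqE /= ltn_eqF.
  - by rewrite (_ : (j == k) = false) ?mulr0 ?addr0// -val_eqE /= gtn_eqF.
  - by rewrite eqxx mulr1 add0r.
have sv (k : 'I_d) : `|s * v 0 k| <= `|s|.
  rewrite normrM ler_piMr//; exact: le_trans (norm_coord _ _) v1.
have step (k : 'I_d) : `|U (mid k.+1) - U (mid k) - s * v 0 k * partial k U x| <=
    e' * `|s|.
  rewrite midS.
  have := @mvt_error R (fun t => U (mid k + t *: 'e_k))
    (fun t => partial k U (mid k + t *: 'e_k)) (partial k U x) e' (s * v 0 k).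
  rewrite scale0r addr0 => H; apply: le_trans (H _ _) _.
  - by move=> t; apply: is_derive_line.
  - move=> t ts; apply: HD => //.
    apply: le_trans (_ : `|s| <= _); last exact: le_trans sdel (bigmin_le _ _ _).
    rewrite /mid -[x + _ + _]addrA [x + _]addrC addrK.
    apply: norm_le => // j; rewrite !mxE eqxx /=.
    have [jk|jk|/val_inj->] := ltngtP j k.
    + by rewrite (_ : (j == k) = false) ?mulr0 ?addr0// -val_eqE /= ltn_eqF.
    + by rewrite (_ : (j == k) = false) ?mulr0 ?addr0 ?normr0// -val_eqE /= gtn_eqF.
    + by rewrite eqxx mulr1 add0r (le_trans ts).
  - by rewrite ler_wpM2l// ltW.
have -> : U (x + s *: v) - U x - s * slope v x =
    \sum_(k < d) (U (mid k.+1) - U (mid k) - s * v 0 k * partial k U x).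
  rewrite sumrB -midd -(big_mkord predT (fun k => U (mid k.+1) - U (mid k))).
  rewrite telescope_sumr// mid0; congr (_ - _).
  by rewrite /slope mulr_sumr; apply: eq_bigr => k _; rewrite mulrA.
apply: le_trans (ler_norm_sum _ _ _) _.
apply: le_trans (ler_sum _ (fun k _ => step k)) _.
rewrite sumr_const card_ord -mulr_natl mulrA ler_wpM2r//.
by rewrite /e' mulrCA ler_piMr ?ltW// ltr_pdivrMr// mul1r ltr_nat.
Qed.

End first_order.

(** * Forward sets and their interior *)

Section neighborhoods.
Context (R : realType) (d : nat).
Implicit Types (x y : 'rV[R]_d) (A : set 'rV[R]_d).

Lemma closure_norm A x :
  closure A x <-> forall e, 0 < e -> exists2 y, A y & `|y - x| < e.
Proof.
split=> [cA e e0|H B /nbhs_ballP[e /= e0 He]].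
  have [y [Ay]] := cA _ (nbhsx_ballx x e e0).
  by rewrite mx_norm_ball /ball_ /= distrC; exists y.
have [y Ay yx] := H e e0; exists y; split => //; apply: He.
by rewrite mx_norm_ball /ball_ /= distrC.
Qed.

Lemma interior_norm A x :
  interior A x <-> exists2 e, 0 < e & forall y, `|y - x| < e -> A y.
Proof.
split=> [/nbhs_ballP[e /= e0 He]|[e e0 He]].
  exists e => // y yx; apply: He.
  by rewrite mx_norm_ball /ball_ /= distrC.
apply/nbhs_ballP; exists e => //= y.
by rewrite mx_norm_ball /ball_ /= distrC; exact: He.
Qed.

Lemma continuous_gt_near (f : 'rV[R]_d -> R) x (c : R) : continuous f -> c < f x ->
  exists2 e, 0 < e & forall y, `|y - x| < e -> c < f y.
Proof.
move=> cf fx; apply/(interior_norm [set y | c < f y]).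
have fc0 : 0 < f x - c by rewrite subr_gt0.
have /cvgrPdist_lt/(_ _ fc0) := cf x.
rewrite /interior /=; apply: filterS => y /=.
by rewrite ltr_norml => /andP[_]; lra.
Qed.

End neighborhoods.

Section velocity.
Context (R : realType) (d : nat).
Implicit Types (eta : 'rV[bool]_d).
Local Notation vel := (@velocity R d).

Lemma velocityE eta i : vel eta 0 i = (-1) ^+ eta 0 i.
Proof. by rewrite mxE. Qed.

Lemma velocity_sqr eta i : vel eta 0 i * vel eta 0 i = 1.
Proof. by rewrite velocityE -expr2 sqrr_sign. Qed.

Lemma norm_velocity eta : `|vel eta| <= 1.
Proof. by apply: norm_le => // i; rewrite velocityE normrX normrN1 expr1n. Qed.

Lemma velocity_flip eta i j :
  vel (flip i eta) 0 j = if j == i then - vel eta 0 j else vel eta 0 j.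
Proof. by rewrite !mxE; case: eqP => // _; case: (eta 0 j); rewrite ?opprK. Qed.

Lemma velocity_flipE eta i :
  vel (flip i eta) = vel eta - (vel eta 0 i *+ 2) *: 'e_i.
Proof.
apply/rowP => j; rewrite velocity_flip !mxE eqxx /=.
have [->|ji] := eqVneq j i; last by rewrite mulr0 subr0.
by rewrite mulr1; ring.
Qed.

Lemma flipK i : involutive (@flip d i).
Proof.
by move=> eta; apply/rowP => j; rewrite !mxE; case: eqP; rewrite ?negbK.
Qed.

Definition reverse eta : 'rV[bool]_d := map_mx negb eta.

Lemma reverseK : involutive reverse.
Proof. by move=> eta; apply/rowP => j; rewrite !mxE negbK. Qed.

Lemma velocity_reverse eta : vel (reverse eta) = - vel eta.
Proof. by apply/rowP => j; rewrite !mxE; case: (eta 0 j); rewrite ?opprK. Qed.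

Lemma reverse_flip i eta : reverse (flip i eta) = flip i (reverse eta).
Proof. by apply/rowP => j; rewrite !mxE; case: eqP. Qed.

End velocity.

Section forward_sets.
Context (R : realType) (d : nat) (U : 'rV[R]_d -> R).
Hypothesis dU : forall i x, derivable U x 'e_i.
Hypothesis cdU : forall i, continuous (partial i U).
Hypothesis cU : continuous U.
Hypothesis coU : coercive U.

Local Notation vel := (@velocity R d).
Implicit Types (S : 'rV[bool]_d -> set 'rV[R]_d) (eta : 'rV[bool]_d) (x : 'rV[R]_d).

Definition uphill i x eta : Prop := 0 < vel eta 0 i * partial i U x.

(** The flip comes with a motion of positive duration, since the pieces of a
    trajectory all have positive length; sets of reachable phases satisfy this
    form, but need not contain the phase reached right after a flip. *)
Record forward S : Prop := Forward {
  forward_move : forall eta x t, 0 <= t -> S eta x -> S eta (x + t *: vel eta);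
  forward_flip : forall i eta x t, 0 < t -> S eta x -> uphill i x eta ->
    S (flip i eta) (x + t *: vel (flip i eta)) }.

(** Instantaneous flips become available in the closure, in the limit of short
    durations. *)
Definition flip_stable S : Prop :=
  forall i eta x, S eta x -> uphill i x eta -> S (flip i eta) x.

Lemma uphill_near i x eta : uphill i x eta ->
  exists2 e, 0 < e & forall y, `|y - x| < e -> uphill i y eta.
Proof.
move=> up; apply: (@continuous_gt_near R d (fun y => vel eta 0 i * partial i U y)).
  by move=> y; apply: continuousM; [exact: cst_continuous|exact: cdU].
exact: up.
Qed.

Lemma uphill_reverse i x eta :
  uphill i x (reverse (flip i eta)) <-> uphill i x eta.
Proof. by rewrite /uphill velocity_reverse mxE velocity_flip eqxx opprK. Qed.

Lemma norm_move eta (t : R) : 0 <= t -> `|t *: vel eta| <= t.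
Proof.
move=> t0; rewrite normrZ ger0_norm//; apply: ler_piMr => //; exact: norm_velocity.
Qed.

Section closed_hull.
Context S (fS : forward S).

Definition closed_hull eta := closure (S eta).

Lemma closed_hull_flip : flip_stable closed_hull.
Proof.
move=> i eta x /closure_norm Sx /uphill_near[e e0 He]; apply/closure_norm => r r0.
pose m := Order.min e (r / 2).
have m0 : 0 < m by rewrite lt_min e0 divr_gt0.
have [y Sy yx] := Sx m m0.
have r4 : 0 < r / 4 by rewrite divr_gt0.
exists (y + (r / 4) *: vel (flip i eta)).
  apply: (forward_flip fS) => //; apply: He; apply: lt_le_trans yx _.
  by rewrite ge_min lexx.
rewrite addrAC; apply: le_lt_trans (ler_normD _ _) _.
have : `|y - x| < r / 2 by apply: lt_le_trans yx _; rewrite ge_min lexx orbT.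
have := norm_move (flip i eta) (ltW r4).
lra.
Qed.

Lemma forward_closed_hull : forward closed_hull.
Proof.
have mv eta x t : 0 <= t -> closed_hull eta x -> closed_hull eta (x + t *: vel eta).
  move=> t0 /closure_norm Sx; apply/closure_norm => e e0.
  have [y Sy yx] := Sx e e0; exists (y + t *: vel eta).
    exact: (forward_move fS).
  by rewrite opprD addrACA subrr addr0.
by split=> // i eta x t t0 Sx up; apply: mv; [exact: ltW|exact: closed_hull_flip].
Qed.

(** Suppose that component [i] can never be flipped, and fix its velocity [sb].
    Let [x] minimise [U - e * sb * x_i] over the positions in the closure of [S]
    that occur with this [i]-th component. All other uphill components can be
    flipped at [x] without moving, so for some velocity there [U] is
    nonincreasing to first order, and moving on strictly decreases the tilted
    potential. *)
Lemma exists_uphill i eta0 x0 : S eta0 x0 ->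
  exists eta x, S eta x /\ uphill i x eta.
Proof.
move=> Sx0.
suff [eta [x [Sx up]]] : exists eta x, closed_hull eta x /\ uphill i x eta.
  have [e e0 He] := uphill_near up.
  have [y Sy yx] := (closure_norm _ _).1 Sx e e0.
  by exists eta, y; split => //; exact: He.
pose b := eta0 0 i; pose sb : R := (-1) ^+ b.
pose C := \bigcup_(eta in [set eta : 'rV[bool]_d | eta 0 i = b]) closed_hull eta.
have clC : closed C.
  apply: closed_bigcup; first exact: finite_finset.
  by move=> eta _; exact: closed_closure.
have [r1 r1U] : exists r1, forall x, r1 <= `|x| -> U x0 + 1 <= U x.
  have [r1 [_ H]] := coU (U x0 + 1).
  by exists (r1 + 1); apply: H; rewrite ltrDl.
pose r := `|r1| + `|x0| + 1.
have r_gt0 : 0 < r by rewrite /r; have := normr_ge0 r1; have := normr_ge0 x0; lra.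
pose A := [set x : 'rV[R]_d | `|x| <= r] `&` C.
have A0 : A x0.
  split; last by exists eta0 => //; exact: subset_closure.
  by rewrite /= /r; have := normr_ge0 r1; lra.
pose e := (4 * r)^-1.
have e_gt0 : 0 < e by rewrite invr_gt0 mulr_gt0.
pose V (x : 'rV[R]_d) := U x - e * (sb * x 0 i).
have cV : continuous V.
  move=> x.
  have cx : {for x, continuous (fun y : 'rV[R]_d => y 0 i)} by exact: coord_continuous.
  have ce : {for x, continuous (fun y : 'rV[R]_d => e * (sb * y 0 i))}.
    by do 2 (apply: continuousM; first exact: cst_continuous).
  exact: (continuousB (@cU x) ce).
have [x] : exists2 x, x \in A & forall t, t \in A -> V x <= V t.
  apply: compact_EVT_min; first by exists x0.
    apply: compact_closedI => //; exact: bounded_ball_compact.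
  exact: continuous_subspaceT.
rewrite inE => -[/= xr [eta1 /= eta1b Sx1]] minx.
have {}minx y : `|y| <= r -> C y -> V x <= V y.
  by move=> yr Cy; apply: minx; rewrite inE.
(* The tilt changes by at most [1 / 2] on the ball of radius [r], so the
   minimiser stays away from the boundary of this ball. *)
have xr1 : `|x| < `|r1|.
  rewrite ltNge; apply/negP => /(le_trans (ler_norm r1))/r1U.
  apply/negP; rewrite -ltNge.
  have := minx x0 A0.1 A0.2; rewrite /V => H.
  have sbn (y : 'rV[R]_d) : `|y| <= r -> `|sb * y 0 i| <= r.
    rewrite normrM normrX normrN1 expr1n mul1r; exact/le_trans/norm_coord.
  have := sbn _ xr; have := sbn _ A0.1; rewrite !ler_norml => /andP[h1 h2] /andP[h3 h4].
  have : e * (sb * x 0 i - sb * x0 0 i) <= e * (r + r).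
    by rewrite ler_wpM2l//; [exact: ltW|lra].
  have -> : e * (r + r) = 1 / 2 by rewrite /e; field; lra.
  by rewrite mulrBr; lra.
pose P eta := (eta 0 i == b) && `[< closed_hull eta x >].
have Peta1 : P eta1 by rewrite /P eta1b eqxx; exact/asboolP.
(* Flipping an uphill component lowers the slope, hence no component but [i]
   can be uphill for a velocity of least slope. *)
case: (arg_minP (fun eta => slope U (vel eta) x) Peta1) => eta /andP[/eqP etab /asboolP Sx].
move=> min_eta.
have [[j up]|no_up] := pselect (exists j, uphill j x eta).
  have [<-|ji] := eqVneq j i; first by exists eta, x.
  have : slope U (vel eta) x <= slope U (vel (flip j eta)) x.
    apply: min_eta; apply/andP; split.
      by rewrite mxE [i == j]eq_sym (negbTE ji) etab.
    by apply/asboolP; exact: closed_hull_flip.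
  rewrite /slope (bigD1 j)//= [leRHS](bigD1 j)//= velocity_flip eqxx.
  rewrite [X in _ <= _ + X -> _](eq_bigr (fun k => vel eta 0 k * partial k U x));
    last first.
    by move=> k kj; rewrite velocity_flip (negbTE kj).
  by rewrite lerD2r mulNr; move: up; rewrite /uphill; lra.
exfalso.
have slope_le0 : slope U (vel eta) x <= 0.
  apply: sumr_le0 => j _; rewrite leNgt; apply/negP => up.
  by apply: no_up; exists j.
have e20 : 0 < e / 2 by rewrite divr_gt0.
have [del del0 Hdel] := first_order dU cdU r e20.
pose s := Order.min del 1.
have s0 : 0 < s by rewrite lt_min del0 ltr01.
have s1 : s <= 1 by rewrite ge_min lexx orbT.
have sdel : s <= del by rewrite ge_min lexx.
have : V x <= V (x + s *: vel eta).
  apply: minx.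
    apply: le_trans (ler_normD _ _) _.
    have := norm_move eta (ltW s0); have := normr_ge0 x0; rewrite /r; lra.
  exists eta => //; apply: (forward_move forward_closed_hull) => //; exact: ltW.
have := Hdel (vel eta) x s (norm_velocity _ _) xr.
rewrite ger0_norm ?(ltW s0)// => /(_ sdel); rewrite ler_norml => /andP[_].
rewrite /V !mxE etab -/sb.
have sb2 : sb * sb = 1 by rewrite -expr2 sqrr_sign.
have -> : sb * (x 0 i + s * sb) = sb * x 0 i + s * (sb * sb) by ring.
rewrite sb2.
have : s * slope U (vel eta) x <= 0 by rewrite mulr_ge0_le0// ltW.
have : 0 < e * s by rewrite mulr_gt0.
rewrite mulrDr mulr1 [e / 2 * s]mulrAC.
lra.
Qed.

End closed_hull.

Section thickening.
Context S (fS : forward S).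

(** In [S eta] lies a neighbourhood of [x] within the affine subspace where only
    the coordinates in [s] vary. *)
Definition thick (s : seq 'I_d) eta x : Prop :=
  exists2 r, 0 < r & forall u : 'rV[R]_d, `|u| < r ->
    (forall j, j \notin s -> u 0 j = 0) -> S eta (x + u).

Lemma forward_thick s : forward (thick s).
Proof.
split=> [eta x t t0 [r r0 H]|i eta x t t0 [r r0 H] up].
  by exists r => // u ur us; rewrite addrAC; apply: (forward_move fS) => //; exact: H.
have [e e0 He] := uphill_near up.
exists (Order.min r e); first by rewrite lt_min r0.
move=> u; rewrite lt_min => /andP[ur ue] us; rewrite addrAC.
apply: (forward_flip fS) => //; first exact: H.
by apply: He; rewrite addrAC subrr add0r.
Qed.

(** Where [i] can be flipped, the instant of the flip is free within a short
    interval; delaying it by [s] moves the endpoint by [2 * s] along coordinate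
    [i], which adds one dimension to the neighbourhood. *)
Lemma thick_cons i s eta0 x0 : thick s eta0 x0 -> exists eta x, thick (i :: s) eta x.
Proof.
move=> Sx0.
have [eta [x [[r r0 H] up]]] := exists_uphill (forward_thick s) i Sx0.
have [e e0 He] := uphill_near up.
pose c := Order.min r e / 2.
have c0 : 0 < c by rewrite divr_gt0// lt_min r0.
have [cr ce] : 2 * c <= r /\ 2 * c <= e.
  rewrite /c mulrC divfK//; split; rewrite ge_min lexx ?orbT//.
set v := vel eta; set v' := vel (flip i eta).
exists (flip i eta), (x + c *: v' + (c * v 0 i) *: 'e_i), c => // u uc us.
pose w : 'rV[R]_d := u - u 0 i *: 'e_i.
pose t := (c + u 0 i * v 0 i) / 2.
have v2 : v 0 i * v 0 i = 1 by exact: velocity_sqr.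
have wE j : w 0 j = if j == i then 0 else u 0 j.
  rewrite !mxE eqxx /=; case: eqP => [->|_]; first by rewrite mulr1 subrr.
  by rewrite mulr0 subr0.
have wc : `|w| < c.
  apply: le_lt_trans uc; apply: norm_le => // j; rewrite wE.
  by case: ifP => _; rewrite ?normr0//; exact: norm_coord.
have : `|u 0 i * v 0 i| < c.
  rewrite normrM [`|v 0 i|](_ : _ = 1) ?mulr1.
    by apply: le_lt_trans uc; exact: norm_coord.
  by rewrite /v velocityE normrX normrN1 expr1n.
rewrite ltr_norml => /andP[uv1 uv2].
have t0 : 0 < t by rewrite /t; lra.
have tc : 0 < c - t by rewrite /t; lra.
have -> : x + c *: v' + (c * v 0 i) *: 'e_i + u = (x + w + t *: v) + (c - t) *: v'.
  rewrite [v']velocity_flipE -/v /t /w; move: {t t0 tc uv1 uv2} (v) v2 => z z2.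
  apply/rowP => j; rewrite !mxE eqxx /=.
  case: eqP => [->|_]; last by rewrite !mulr0; lra.
  have -> : u 0 i = (u 0 i * z 0 i) * z 0 i by rewrite -mulrA z2 mulr1.
  rewrite !mulr1; set q := z 0 i; rewrite -/q in z2.
  have E : u 0 i * q * q * q = u 0 i * q by rewrite -mulrA z2 mulr1.
  by rewrite E; lra.
apply: (forward_flip fS) => //.
  apply: (forward_move fS) => //; first exact: ltW.
  apply: H; first by apply: lt_le_trans wc _; lra.
  move=> j js; rewrite wE; case: eqP => // /eqP ji.
  by apply: us; rewrite inE negb_or ji.
apply: He; rewrite -[x + w + _]addrA [x + _]addrC addrK.
apply: le_lt_trans (ler_normD _ _) _.
have := norm_move eta (ltW t0); rewrite -/v; lra.
Qed.

Lemma forward_interior eta0 x0 : S eta0 x0 ->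
  exists eta x, interior (S eta) x.
Proof.
move=> Sx0.
have [eta [x [r r0 H]]] : exists eta x, thick (enum 'I_d) eta x.
  elim: (enum 'I_d) => [|i s [eta [x Sx]]]; last exact: thick_cons Sx.
  exists eta0, x0, 1 => // u _ u0.
  by rewrite (_ : u = 0) ?addr0//; apply/rowP => j; rewrite u0// mxE.
exists eta, x; apply/interior_norm; exists r => // y yr.
rewrite -(subrK x y) addrC; apply: H => // j.
by rewrite mem_enum.
Qed.

End thickening.
End forward_sets.

(** * A cyclic grid in a cube *)

Section grid.
Context (R : realType) (d : nat) (c : nat) (h : R).
Hypothesis h0 : 0 < h.
Local Notation vel := (@velocity R d).

Definition grid := {ffun 'I_d -> 'I_(c.*2.+1)}.
Implicit Types (k : grid) (eta : 'rV[bool]_d).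

Definition pos k : 'rV[R]_d := \row_i (h * ((k i)%:R - c%:R)).

(** One step of the grid along the velocity [eta], with wrap-around at the
    faces of the cube: being a bijection, it allows summation by parts. *)
Definition shift eta k : grid :=
  [ffun i => if eta 0 i then ord_pred (k i) else ordS (k i)].

Lemma shiftK eta : cancel (shift eta) (shift (reverse eta)).
Proof.
move=> k; apply/ffunP => i; rewrite !ffunE mxE.
by case: (eta 0 i) => /=; rewrite ?ord_predK ?ordSK.
Qed.

Lemma shift_inj eta : injective (shift eta).
Proof. exact: can_inj (shiftK eta). Qed.

Lemma posE k i : pos k 0 i = h * ((k i)%:R - c%:R).
Proof. by rewrite mxE. Qed.

Lemma norm_pos k : `|pos k| <= h * c%:R.
Proof.
apply: norm_le => [|i]; first by rewrite mulr_ge0// ltW.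
rewrite posE normrM (ger0_norm (ltW h0)) ler_pM2l// ler_norml.
have : (k i)%:R <= c.*2%:R :> R by rewrite ler_nat -ltnS.
have -> : c.*2%:R = c%:R + c%:R :> R by rewrite -addnn natrD.
have : 0 <= (k i)%:R :> R by [].
lra.
Qed.

Lemma pos_shift eta k :
  pos (shift eta k) = pos k + h *: vel eta \/
  h * c%:R <= `|pos k| /\ h * c%:R <= `|pos (shift eta k)|.
Proof.
have edge k' i : k' i = 0%N :> nat \/ k' i = c.*2 :> nat -> h * c%:R <= `|pos k'|.
  move=> H; apply: le_trans (norm_coord _ i); rewrite posE normrM (ger0_norm (ltW h0)).
  rewrite ler_pM2l//; case: H => ->; first by rewrite sub0r normrN ger0_norm.
  by rewrite -addnn natrD addrK ger0_norm.
have [[i wrap]|nowrap] := pselect (exists i, k i = (if eta 0 i then 0%N else c.*2) :> nat).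
  right; split; apply: (edge _ i).
    by move: wrap; case: (eta 0 i); [left|right].
  rewrite ffunE; move: wrap; case: (eta 0 i) => /= ->.
    by right; rewrite add0n /= modn_small.
  by left; rewrite modnn.
left; apply/rowP => i; rewrite !mxE ffunE.
have /eqP : (k i : nat) <> (if eta 0 i then 0%N else c.*2).
  by move=> ki; apply: nowrap; exists i.
case: (eta 0 i) => /= ki.
  have k1 : (0 < k i)%N by rewrite lt0n.
  rewrite -(prednK k1) addSn /= addnC modnDl modn_small; last first.
    by rewrite (leq_ltn_trans (leq_pred _)).
  by rewrite -natr1 expr1; ring.
have kc : (k i < c.*2)%N by rewrite ltn_neqAle ki -ltnS ltn_ord.
by rewrite modn_small// -natr1 expr0; ring.
Qed.

Lemma pos_shift_inside eta k : `|pos k| < h * c%:R ->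
  pos (shift eta k) = pos k + h *: vel eta.
Proof. by move=> kL; case: (pos_shift eta k) => // -[]; rewrite leNgt kL. Qed.

(** Wrap-around only concerns points of the boundary of the cube, where the
    weight [g] and its translate vanish. *)
Lemma sum_shift eta (phi g : 'rV[R]_d -> R) :
  (forall x, h * c%:R - h <= `|x| -> g x = 0) ->
  \sum_k phi (pos k + h *: vel eta) * g (pos k) =
  \sum_k phi (pos k) * g (pos k - h *: vel eta).
Proof.
move=> g0.
rewrite [RHS](reindex_inj (@shift_inj eta)); apply: eq_bigr => k _.
case: (pos_shift eta k) => [->|[ck ck']]; first by rewrite addrK.
rewrite g0 ?mulr0; last by apply: le_trans ck; rewrite gerBl ltW.
rewrite g0 ?mulr0//.
have := norm_velocity R eta => v1.
have : `|h *: vel eta| <= h by rewrite normrZ (ger0_norm (ltW h0)) ler_piMr// ltW.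
have := ler_normB (pos (shift eta k) - h *: vel eta) (- (h *: vel eta)).
rewrite opprK subrK normrN; lra.
Qed.

Lemma iter_shift eta y (r : R) m k : `|pos k - y| <= r ->
  `|y| + r + m%:R * h < h * c%:R ->
  forall j, (j <= m)%N -> pos (iter j (shift eta) k) = pos k + (j%:R * h) *: vel eta.
Proof.
move=> ky yr; elim=> [_|j IH jm]; first by rewrite mul0r scale0r addr0.
have {}IH := IH (ltnW jm).
rewrite iterS pos_shift_inside IH; first by rewrite -addrA -scalerDl -natr1 mulrDl mul1r.
apply: le_lt_trans yr; apply: le_trans (ler_normD _ _) _; apply: lerD.
  rewrite -(subrK y (pos k)) addrC; apply: le_trans (ler_normD _ _) _.
  by rewrite lerD2l.
have jh0 : 0 <= j%:R * h by rewrite mulr_ge0// ltW.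
rewrite normrZ (ger0_norm jh0); apply: le_trans (ler_piMr jh0 (norm_velocity _ _)) _.
by rewrite ler_pM2r// ler_nat ltnW.
Qed.

Lemma grid_coord_density (z rho : R) : 0 < rho -> `|z| + rho <= h * c%:R ->
  (Num.trunc (rho / h) <= #|[pred j : 'I_(c.*2.+1) |
     (`|h * ((j : nat)%:R - c%:R) - z| <= rho)%R]|)%N.
Proof.
move=> rho0 zr.
set q := Num.trunc _.
have q_le : q%:R * h <= rho.
  by rewrite -ler_pdivlMr// truncn_le divr_ge0// ltW.
pose z' := z / h + c%:R.
have z'h : z' * h = z + h * c%:R by rewrite /z'; field; rewrite gt_eqF.
have z'0 : 0 <= z'.
  rewrite -(pmulr_lge0 _ h0) z'h; have := ler_norm (- z); rewrite normrN; lra.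
pose j0 := Num.trunc z'.
have [j0le j0lt] : j0%:R <= z' /\ z' < j0%:R + 1.
  by have := truncn_itv z'0; rewrite -natr1 => /andP[].
have tq (t : 'I_q) : (t : nat)%:R + 1 <= q%:R :> R by rewrite natr1 ler_nat.
have small (t : 'I_q) : (j0 + t.+1 < c.*2.+1)%N.
  rewrite ltnS -(ler_nat R) natrD -natr1 -addnn natrD -(ler_pM2r h0).
  have : (j0%:R + ((t : nat)%:R + 1)) * h <= (z' + q%:R) * h.
    by rewrite ler_pM2r// lerD.
  rewrite [(z' + _) * h]mulrDl z'h; have := ler_norm z.
  by rewrite [(c%:R + _) * h]mulrDl [c%:R * h]mulrC; lra.
pose F (t : 'I_q) : 'I_(c.*2.+1) := Ordinal (small t).
have Finj : injective F.
  by move=> t1 t2 [] /eqP; rewrite eqn_add2l eqSS => /eqP/val_inj.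
rewrite -[q]card_ord -(card_imset _ Finj); apply: subset_leq_card.
apply/fintype.subsetP => j /imsetP[t _ ->]; rewrite inE /=.
rewrite natrD -natr1.
have -> : h * (j0%:R + ((t : nat)%:R + 1) - c%:R) - z =
   (j0%:R + ((t : nat)%:R + 1)) * h - z' * h by rewrite z'h; ring.
have : ((t : nat)%:R + 1) * h <= q%:R * h by rewrite ler_pM2r.
have : 0 <= (t : nat)%:R * h by rewrite mulr_ge0// ltW.
have : j0%:R * h <= z' * h by rewrite ler_pM2r.
have : z' * h < (j0%:R + 1) * h by rewrite ltr_pM2r.
by rewrite !mulrDl mul1r ler_norml; lra.
Qed.

(** A ball contains a proportion of the grid points that is bounded below
    independently of the mesh. *)
Lemma grid_density (y : 'rV[R]_d) (rho : R) : 0 < rho ->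
  `|y| + rho <= h * c%:R -> h <= rho / 2 ->
  (rho / (6 * (h * c%:R))) ^+ d * #|{: grid}|%:R <=
    #|[pred k : grid | `|pos k - y| <= rho]|%:R.
Proof.
move=> rho0 yr hr; have hgt0 := h0.
set q := Num.trunc (rho / h).
have q_ge : rho / (2 * h) <= q%:R.
  have rh : 0 <= rho / h by rewrite divr_ge0// ltW.
  have := truncn_itv rh; rewrite -/q -natr1 => /andP[_].
  have : 2 <= rho / h by rewrite ler_pdivlMr//; lra.
  have -> : rho / (2 * h) = (rho / h) / 2 by field; rewrite gt_eqF.
  lra.
apply: (@le_trans _ _ (q%:R ^+ d)).
  rewrite card_ffun !card_ord natrX -exprMn; apply: lerXn2r.
  - rewrite nnegrE; apply: mulr_ge0 => //; apply: divr_ge0; first exact: ltW.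
    by have := normr_ge0 y; lra.
  - by rewrite nnegrE.
  apply: le_trans q_ge.
  have hc : 2 * h <= h * c%:R by have := normr_ge0 y; lra.
  have c2 : 2 <= c%:R :> R by rewrite -(ler_pM2l h0) mulrC.
  have -> : rho / (2 * h) = rho / (6 * (h * c%:R)) * (3 * c%:R).
    by field; rewrite !gt_eqF//; lra.
  have A0 : 0 <= rho / (6 * (h * c%:R)) by apply: divr_ge0; lra.
  apply: (ler_wpM2l A0).
  by rewrite -natr1 -addnn natrD; lra.
pose near_coord i : pred 'I_(c.*2.+1) :=
  [pred j : 'I_(c.*2.+1) | `|h * ((j : nat)%:R - c%:R) - y 0 i| <= rho].
have sub : (#|family near_coord| <= #|[pred k : grid | (`|pos k - y| <= rho)%R]|)%N.
  apply: subset_leq_card; apply/fintype.subsetP => k /familyP Hk.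
  rewrite inE; apply: norm_le => [|i]; first exact: ltW.
  by have := Hk i; rewrite inE !mxE.
rewrite -natrX ler_nat; apply: leq_trans sub; rewrite card_family.
have prod_ge (s : seq nat) : all (leq q) s -> (q ^ size s <= foldr muln 1 s)%N.
  by elim: s => //= a s IH /andP[qa /IH]; rewrite expnS; exact: leq_mul.
have := prod_ge [seq #|near_coord i| | i : 'I_d].
rewrite size_image card_ord; apply; apply/allP => _ /mapP[i _ ->].
apply: grid_coord_density => //.
by apply: le_trans yr; rewrite lerD2r; exact: norm_coord.
Qed.

End grid.

Lemma grid_card_gt0 (R : numDomainType) d c : 0 < #|grid d c|%:R :> R.
Proof. by rewrite ltr0n; apply/card_gt0P; exists [ffun => ord0]. Qed.

(** * Balance of mass for truncated densities *)

Section balance.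
Context (R : realType) (d : nat) (U : 'rV[R]_d -> R).
Hypothesis dU : forall i x, derivable U x 'e_i.
Hypothesis cdU : forall i, continuous (partial i U).
Hypothesis cU : continuous U.
Hypothesis coU : coercive U.

Local Notation vel := (@velocity R d).
Implicit Types (eta : 'rV[bool]_d) (x y : 'rV[R]_d).

(** The density is the square of this truncation, which makes it continuously
    differentiable and compactly supported. *)
Definition weight (M : R) x := Num.max 0 (M - U x).

Lemma weight_ge0 M x : 0 <= weight M x.
Proof. by rewrite le_max lexx. Qed.

(** The function [u |-> max(0, M - u)^2] is convex with second derivative at
    most [2]. *)
Lemma weight_sqr_le M x y :
  weight M y ^+ 2 <= weight M x ^+ 2 - 2 * weight M x * (U y - U x) + (U y - U x) ^+ 2.
Proof.
rewrite /weight; set a := M - U x; set b := M - U y.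
have -> : U y - U x = a - b by rewrite /a /b; ring.
have [a0|a0] := leP 0 a.
  have -> : a ^+ 2 - 2 * a * (a - b) + (a - b) ^+ 2 = b ^+ 2 by ring.
  by have [b0|b0] := leP 0 b; rewrite ?lexx// expr0n sqr_ge0.
rewrite expr0n mulr0 mul0r subr0 add0r; have [b0|b0] := leP 0 b.
  rewrite -[leRHS]sqrrN opprB; apply: lerXn2r; rewrite ?nnegrE; lra.
by rewrite expr0n sqr_ge0.
Qed.

Lemma slope_bound (r : R) : exists B, forall eta x, `|x| <= r -> `|slope U (vel eta) x| <= B.
Proof.
have /choice[B HB] : forall i : 'I_d, exists B, forall x, `|x| <= r -> `|partial i U x| <= B.
  by move=> i; exact: compact_bound.
exists (\sum_i B i) => eta x xr.
apply: le_trans (ler_norm_sum _ _ _) _; apply: ler_sum => i _.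
by rewrite normrM velocityE normrX normrN1 expr1n mul1r; exact: HB.
Qed.

Lemma weight_step (L M e : R) : 0 < e ->
  exists2 del, 0 < del & forall eta x h, `|x| <= L -> 0 < h -> h <= del ->
    weight M (x - h *: vel eta) ^+ 2 <=
    weight M x ^+ 2 + 2 * h * weight M x * slope U (vel eta) x + h * e.
Proof.
move=> e0.
have [BU HBU] := compact_bound L cU.
have [Bs HBs] := slope_bound L.
pose B := `|M| + `|BU| + `|Bs| + 1.
have B0 : 0 < B by rewrite ltr_wpDl.
have wB x : `|x| <= L -> weight M x <= B.
  move=> xL; rewrite ge_max (ltW B0) /=.
  have := HBU _ xL; rewrite ler_norml => /andP[H1 _].
  have := ler_norm M; have := ler_norm BU; have := normr_ge0 Bs; rewrite /B; lra.
pose e' := Order.min 1 (e / (4 * B)).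
have e'0 : 0 < e' by rewrite lt_min ltr01 divr_gt0// mulr_gt0.
have [del del0 Hdel] := first_order dU cdU L e'0.
pose C := (B + 1) ^+ 2.
have C0 : 0 < C by rewrite exprn_gt0// addr_gt0.
exists (Order.min del (e / (2 * C))).
  by rewrite lt_min del0 divr_gt0// mulr_gt0.
move=> eta x h xL h0; rewrite le_min => /andP[hdel hC].
have := Hdel (vel eta) x (- h) (norm_velocity _ _) xL.
rewrite normrN (gtr0_norm h0) => /(_ hdel); rewrite scaleNr mulNr opprK.
set D := U _ - U x; set s := slope _ _ _ => HD.
have w0 := weight_ge0 M x; have wleB := wB x xL.
apply: le_trans (weight_sqr_le M x _) _; rewrite -/D.
have sB : `|s| <= B.
  apply: le_trans (HBs eta x xL) _; rewrite /B.
  by have := ler_norm Bs; have := normr_ge0 M; have := normr_ge0 BU; lra.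
have e'1 : e' <= 1 by rewrite ge_min lexx.
have e'B : e' * (4 * B) <= e.
  by rewrite -ler_pdivlMr ?mulr_gt0// /e' ge_min lexx orbT.
have D2 : D ^+ 2 <= h * (e / 2).
  have absD : `|D| <= h * (B + 1).
    have -> : D = (D + h * s) - h * s by ring.
    apply: le_trans (ler_normB _ _) _; rewrite normrM (gtr0_norm h0).
    have : h * `|s| <= h * B by rewrite ler_pM2l.
    have : e' * h <= 1 * h by rewrite ler_pM2r.
    lra.
  rewrite -[D ^+ 2]ger0_norm ?sqr_ge0// normrX.
  apply: le_trans (_ : (h * (B + 1)) ^+ 2 <= _).
    by apply: lerXn2r => //; rewrite nnegrE// mulr_ge0// ?ltW// addr_gt0.
  rewrite exprMn -/C expr2 -mulrA ler_pM2l//.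
  by move: hC; rewrite ler_pdivlMr ?mulr_gt0//; lra.
have wD : - (2 * weight M x * D) <= 2 * h * weight M x * s + h * (e / 2).
  have : D + h * s >= - (e' * h) by move: HD; rewrite ler_norml => /andP[].
  move=> H.
  have : 2 * weight M x * (- (e' * h)) <= 2 * weight M x * (D + h * s).
    by rewrite ler_wpM2l// mulr_ge0.
  have : (2 * h * e') * weight M x <= (2 * h * e') * B.
    by rewrite ler_wpM2l// ?mulr_ge0// ltW.
  have : h * (e' * (4 * B)) <= h * e by rewrite ler_pM2l.
  lra.
lra.
Qed.

Section forward_balance.
Context (K : 'rV[bool]_d -> set 'rV[R]_d).
Hypothesis fK : forward U K.
Hypothesis flK : flip_stable U K.

Definition indic eta x : R := (`[< K eta x >])%:R.

Lemma indic_ge0 eta x : 0 <= indic eta x.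
Proof. by []. Qed.

Lemma indic_le1 eta x : indic eta x <= 1.
Proof. by rewrite /indic; case: asboolP. Qed.

Lemma indic_le eta eta' x y : (K eta x -> K eta' y) -> indic eta x <= indic eta' y.
Proof.
rewrite /indic => H; case: asboolP => [/H/asboolP->//|_]; exact: indic_ge0.
Qed.

Definition in_ball (r : R) x : bool := `|x| <= r.

(** The rate at which flips of component [i] between [eta] and [flip i eta]
    carry mass into [K]: one of these velocities is uphill, and when [K] is
    stable under uphill flips, mass can only move from the outside to the
    inside. The expression is the same for both velocities. *)
Definition flip_flux i eta x : R :=
  (indic (flip i eta) x - indic eta x) * (vel eta 0 i * partial i U x).

Lemma flip_flux_ge0 i eta x : 0 <= flip_flux i eta x.
Proof.
rewrite /flip_flux; set a := vel eta 0 i * _.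
have [a0|a0|->] := ltgtP a 0; last by rewrite mulr0.
- rewrite mulr_le0 ?(ltW a0)// subr_le0; apply: indic_le => Kx.
  rewrite -[eta](flipK i); apply: flK => //.
  by rewrite /uphill velocity_flip eqxx mulNr oppr_gt0.
- by rewrite mulr_ge0 ?(ltW a0)// subr_ge0; apply: indic_le => Kx; exact: flK.
Qed.

(** Transport along [eta] and flips balance: [eta] and [flip i eta] have
    opposite [i]-th components, so the transport terms of such a pair combine
    into minus their flip flux, which the sum over [eta] counts twice. *)
Lemma slope_pairing x : \sum_eta indic eta x * slope U (vel eta) x =
  - (\sum_i \sum_eta flip_flux i eta x) / 2.
Proof.
have -> : \sum_eta indic eta x * slope U (vel eta) x =
    \sum_i \sum_eta indic eta x * (vel eta 0 i * partial i U x).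
  by rewrite exchange_big; apply: eq_bigr => eta _; rewrite mulr_sumr.
rewrite -sumrN mulr_suml; apply: eq_bigr => i _.
under [in RHS]eq_bigr do rewrite /flip_flux mulrBl.
rewrite sumrB [X in - (X - _)](reindex_inj (inv_inj (flipK i))) /=.
under [X in - (X - _)]eq_bigr do rewrite flipK velocity_flip eqxx mulNr mulrN.
by rewrite sumrN; field.
Qed.

(** Translating the weight instead of the set, the mass that enters [K] during
    a motion of duration [h] is at most [h] times a sum of slope terms, up to
    [o(h)] per grid point. By [slope_pairing] these terms add up to minus a
    nonnegative flip flux. So the two inflows, both nonnegative, are at most
    [o(h)] per grid point together. *)
Lemma balance (r : R) : exists L0, forall L e, L0 <= L -> 0 < e ->
  exists2 del, 0 < del & forall (h : R) (c : nat), 0 < h -> h <= del -> h * c%:R = L ->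
  (forall eta, \sum_(k : grid d c)
     (indic eta (pos h k + h *: vel eta) - indic eta (pos h k)) * (in_ball r (pos h k))%:R
     <= h * e * #|grid d c|%:R) /\
  (forall i eta, \sum_(k : grid d c) flip_flux i eta (pos h k) * (in_ball r (pos h k))%:R
     <= e * #|grid d c|%:R).
Proof.
have [BU HBU] := compact_bound r cU.
pose M := BU + 1.
have [Lc [_ HLc]] := coU M.
exists (`|Lc| + 2) => L e LL e0.
pose N : R := #|{: 'rV[bool]_d}|%:R.
have N0 : 0 < N by rewrite ltr0n; apply/card_gt0P; exists (\row_i false).
have eN0 : 0 < e / N by rewrite divr_gt0.
have [del del0 Hdel] := weight_step L M eN0.
exists (Order.min 1 del); first by rewrite lt_min ltr01.
move=> h c h0; rewrite le_min => /andP[h1 hdel] hcL.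
have weight0 x : h * c%:R - h <= `|x| -> weight M x ^+ 2 = 0.
  rewrite hcL => xL; rewrite /weight max_l; first by rewrite expr0n.
  rewrite subr_le0; apply: (HLc `|x|) => //.
  by have := ler_norm Lc; lra.
pose G : R := #|grid d c|%:R.
pose p k := @pos R d c h k.
have pL k : `|p k| <= L by rewrite -hcL; exact: norm_pos.
pose A eta := \sum_k
  (indic eta (p k + h *: vel eta) - indic eta (p k)) * weight M (p k) ^+ 2.
pose Q := \sum_k weight M (p k) * \sum_i \sum_eta flip_flux i eta (p k).
have AQ : \sum_eta A eta + h * Q <= h * e * G.
  have AE eta : A eta <= \sum_k indic eta (p k) *
      (2 * h * weight M (p k) * slope U (vel eta) (p k)) + h * (e / N) * G.
    rewrite /A; under eq_bigr do rewrite mulrBl.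
    have /= parts := @sum_shift _ _ _ _ h0 eta (indic eta) (fun x => weight M x ^+ 2) weight0.
    rewrite sumrB parts -sumrB.
    have -> : h * (e / N) * G = \sum_(k : grid d c) h * (e / N).
      by rewrite sumr_const mulr_natr.
    rewrite -big_split; apply: ler_sum => k _ /=.
    rewrite -mulrBr.
    apply: le_trans (_ : indic eta (p k) * (2 * h * weight M (p k) *
       slope U (vel eta) (p k) + h * (e / N)) <= _).
      rewrite ler_wpM2l ?indic_ge0// lerBlDl addrA.
      exact: Hdel.
    by rewrite mulrDr lerD2l ler_piMl ?indic_le1// mulr_ge0 ?ltW.
  apply: le_trans (lerD (ler_sum _ (fun eta _ => AE eta)) (lexx _)) _.
  rewrite big_split /= exchange_big /=.
  have -> : \sum_(eta : 'rV[bool]_d) h * (e / N) * G = h * e * G.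
    by rewrite sumr_const -mulr_natl -/N; field; rewrite gt_eqF.
  have -> : \sum_k \sum_eta indic eta (p k) *
     (2 * h * weight M (p k) * slope U (vel eta) (p k)) = - (h * Q).
    rewrite /Q mulr_sumr -sumrN; apply: eq_bigr => k _.
    under eq_bigr do rewrite mulrCA.
    by rewrite -mulr_sumr slope_pairing; field.
  by lra.
have A_ge eta (k : grid d c) : 0 <= indic eta (p k + h *: vel eta) - indic eta (p k).
  by rewrite subr_ge0; apply: indic_le => Kx; apply: (forward_move fK) => //; exact: ltW.
have A0 eta : 0 <= A eta by apply: sumr_ge0 => k _; rewrite mulr_ge0// sqr_ge0.
have Q0 : 0 <= Q.
  apply: sumr_ge0 => k _; rewrite mulr_ge0 ?weight_ge0//.
  by do 2 (apply: sumr_ge0 => ? _); exact: flip_flux_ge0.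
have w1 k : (in_ball r (p k))%:R <= weight M (p k).
  have [kr|_] := boolP (in_ball r (p k)); last exact: weight_ge0.
  rewrite /weight le_max; apply/orP; right.
  by have := HBU _ kr; rewrite ler_norml /M /=; lra.
have w2 k : (in_ball r (p k))%:R <= weight M (p k) ^+ 2.
  have -> : (in_ball r (p k))%:R = (in_ball r (p k))%:R ^+ 2 :> R.
    by case: in_ball; rewrite ?expr1n ?expr0n.
  by apply: lerXn2r; rewrite ?nnegrE ?weight_ge0.
split=> [eta|i eta].
  apply: le_trans (_ : A eta <= _).
    by apply: ler_sum => k _; rewrite ler_wpM2l.
  apply: le_trans AQ; rewrite (bigD1 eta)//= -addrA lerDl addr_ge0//.
    by apply: sumr_ge0 => *.
  by rewrite mulr_ge0// ltW.
rewrite -(ler_pM2l h0) mulrA; apply: le_trans AQ.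
apply: le_trans (_ : h * Q <= _); last by rewrite lerDr sumr_ge0.
rewrite ler_pM2l//; apply: ler_sum => k _; rewrite mulrC.
apply: le_trans (_ : weight M (p k) * flip_flux i eta (p k) <= _).
  by rewrite ler_wpM2r ?flip_flux_ge0.
rewrite ler_wpM2l ?weight_ge0// (bigD1 i)//= (bigD1 eta)//= -addrA lerDl addr_ge0//.
  by apply: sumr_ge0 => ? _; exact: flip_flux_ge0.
by do 2 (apply: sumr_ge0 => ? _); exact: flip_flux_ge0.
Qed.

End forward_balance.
End balance.

(** * Time-reversibility and density of forward sets *)

Section reversibility.
Context (R : realType) (d : nat) (U : 'rV[R]_d -> R).
Hypothesis dU : forall i x, derivable U x 'e_i.
Hypothesis cdU : forall i, continuous (partial i U).
Hypothesis cU : continuous U.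
Hypothesis coU : coercive U.

Local Notation vel := (@velocity R d).
Implicit Types (eta : 'rV[bool]_d) (x y : 'rV[R]_d).

Lemma exists_small_step (T del : R) : 0 < T -> 0 < del ->
  exists m, T / m.+1%:R <= del.
Proof.
move=> T0 del0; exists (Num.trunc (T / del)).
by rewrite ler_pdivrMr// -ler_pdivrMl// mulrC ltW// truncnS_gt.
Qed.

Section closed_sets.
Context (K : 'rV[bool]_d -> set 'rV[R]_d).
Hypothesis fK : forward U K.
Hypothesis flK : flip_stable U K.

(** If [K eta] missed the ball around [y], all points of this ball would enter
    it within the time [T]. Cutting [T] into [m] steps of the grid, they cannot
    be more numerous than [m] times the inflow of one step, which by [balance]
    is a small proportion of the grid, whereas by [grid_density] the ball holds
    a fixed proportion. *)
Lemma back_hits eta y (T rho : R) : 0 < T -> 0 < rho ->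
  (forall z, `|z - (y + T *: vel eta)| <= rho -> K eta z) ->
  exists2 z, `|z - y| <= rho & K eta z.
Proof.
move=> T0 rho0 KT; apply: contrapT => noK.
pose r := `|y| + rho + T.
have r0 : 0 < r by rewrite /r; have := normr_ge0 y; lra.
have [L0 HL0] := balance dU cdU cU coU fK flK r.
(* The half-width [L] of the cube and the duration [T] have to be multiples of
   the mesh [h] at the same time. *)
pose q := (Num.trunc ((`|L0| + r + 1) / T)).+1.
pose L := q%:R * T.
have LL : `|L0| + r + 1 < L by rewrite /L -ltr_pdivrMr// truncnS_gt.
have L0L : L0 <= L by have := ler_norm L0; lra.
have Lgt0 : 0 < L by have := normr_ge0 L0; lra.
pose kappa := (rho / (6 * L)) ^+ d.
have kappa0 : 0 < kappa by rewrite exprn_gt0// divr_gt0// mulr_gt0.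
have e0 : 0 < kappa / (2 * T) by rewrite divr_gt0// mulr_gt0.
have [del del0 Hdel] := HL0 L _ L0L e0.
have m0 : 0 < Order.min del (rho / 2) by rewrite lt_min del0 divr_gt0.
have [m'] := exists_small_step T0 m0; set m := m'.+1.
have mgt0 : 0 < m%:R :> R by rewrite ltr0n.
set h := T / m%:R; rewrite le_min => /andP[hdel hrho].
have h0 : 0 < h by rewrite divr_gt0.
have mh : m%:R * h = T by rewrite /h; field; rewrite gt_eqF.
have hcL : h * (q * m)%N%:R = L by rewrite natrM mulrCA [h * _]mulrC mh.
have [/(_ eta) HF _] := Hdel h (q * m)%N h0 hdel hcL.
have dens : kappa * #|grid d (q * m)|%:R <=
    #|[pred k : grid d (q * m) | (`|pos h k - y| <= rho)%R]|%:R.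
  rewrite /kappa -hcL; apply: grid_density => //.
  by rewrite hcL; have := normr_ge0 L0; rewrite /r in LL; lra.
pose p (k : grid d (q * m)) := pos h k.
pose F x := (indic K eta (x + h *: vel eta) - indic K eta x) * (in_ball r x)%:R.
have F0 x : 0 <= F x.
  rewrite mulr_ge0// subr_ge0; apply: indic_le => Kx.
  by apply: (forward_move fK) => //; exact: ltW.
have one k : `|p k - y| <= rho -> 1 <= \sum_(j < m) F (p (iter j (shift eta) k)).
  move=> ky.
  have pj j : (j <= m)%N -> p (iter j (shift eta) k) = p k + (j%:R * h) *: vel eta.
    apply: (@iter_shift _ _ _ _ h0 _ y rho) => //; rewrite hcL mh.
    by have := normr_ge0 L0; rewrite /r in LL; lra.
  have E (j : 'I_m) : F (p (iter j (shift eta) k)) =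
      indic K eta (p k + (j.+1%:R * h) *: vel eta) -
      indic K eta (p k + (j%:R * h) *: vel eta).
    rewrite /F pj ?(ltnW (ltn_ord j))//.
    have -> : in_ball r (p k + (j%:R * h) *: vel eta).
      rewrite /in_ball -(subrK y (p k)).
      apply: le_trans (ler_normD _ _) _; rewrite /r; apply: lerD.
        by apply: le_trans (ler_normD _ _) _; rewrite addrC lerD2l.
      have jh0 : 0 <= j%:R * h by rewrite mulr_ge0// ltW.
      apply: le_trans (norm_move eta jh0) _.
      by rewrite -mh ler_pM2r// ler_nat ltnW.
    by rewrite mulr1 -addrA -scalerDl -natr1 mulrDl mul1r.
  rewrite (eq_bigr _ (fun j _ => E j)).
  rewrite -(big_mkord predT (fun j => indic K eta (p k + (j.+1%:R * h) *: vel eta) -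
    indic K eta (p k + (j%:R * h) *: vel eta))) telescope_sumr//.
  rewrite mh mul0r scale0r addr0 /indic.
  have -> : `[< K eta (p k + T *: vel eta) >] = true.
    by apply/asboolP; apply: KT; rewrite opprD addrACA subrr addr0.
  have -> : `[< K eta (p k) >] = false by apply/asboolP => Kk; apply: noK; exists (p k).
  by rewrite subr0.
have : #|[pred k : grid d (q * m) | (`|pos h k - y| <= rho)%R]|%:R <=
    kappa / 2 * #|grid d (q * m)|%:R.
  rewrite -sum1_card natr_sum.
  apply: le_trans (ler_sum _ (fun k (kb : k \in [pred k | _]) => one k kb)) _.
  apply: le_trans (_ : \sum_k \sum_(j < m) F (p (iter j (shift eta) k)) <= _).
    rewrite [leRHS](bigID [pred k | (`|p k - y| <= rho)%R])/= lerDl.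
    by apply: sumr_ge0 => k _; apply: sumr_ge0.
  rewrite exchange_big /=.
  have S j : \sum_k F (p (iter j (shift eta) k)) = \sum_k F (p k).
    elim: j => // j IH; rewrite -IH [RHS](reindex_inj (@shift_inj d (q * m) eta)).
    by apply: eq_bigr => k _; rewrite -iterSr.
  rewrite (eq_bigr (fun=> \sum_k F (p k))); last by move=> j _; exact: S.
  rewrite sumr_const card_ord -[leLHS]mulr_natl.
  have -> : kappa / 2 * #|grid d (q * m)|%:R =
     m%:R * (h * (kappa / (2 * T)) * #|grid d (q * m)|%:R).
    by rewrite -[h * _ * _]mulrA [RHS]mulrA mh; field; rewrite gt_eqF.
  by rewrite ler_pM2l.
have G0 := grid_card_gt0 R d (q * m).
have : 0 < kappa * #|grid d (q * m)|%:R by rewrite mulr_gt0.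
lra.
Qed.

(** If [K eta] missed a ball contained in [K (flip i eta)], every point of the
    ball would contribute at least [a] to the flip flux. *)
Lemma flip_hits i eta y (a rho : R) : 0 < a -> 0 < rho ->
  (forall z, `|z - y| <= rho -> K (flip i eta) z /\ a <= vel eta 0 i * partial i U z) ->
  exists2 z, `|z - y| <= rho & K eta z.
Proof.
move=> a0 rho0 Kfl; apply: contrapT => noK.
pose r := `|y| + rho.
have r0 : 0 < r by rewrite /r; have := normr_ge0 y; lra.
have [L0 HL0] := balance dU cdU cU coU fK flK r.
pose L := `|L0| + r.
have L0L : L0 <= L by have := ler_norm L0; rewrite /L; lra.
have Lgt0 : 0 < L by have := normr_ge0 L0; rewrite /L; lra.
pose kappa := (rho / (6 * L)) ^+ d.
have kappa0 : 0 < kappa by rewrite exprn_gt0// divr_gt0// mulr_gt0.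
have e0 : 0 < kappa * a / 2 by rewrite divr_gt0// mulr_gt0.
have [del del0 Hdel] := HL0 L _ L0L e0.
have m0 : 0 < Order.min del (rho / 2) by rewrite lt_min del0 divr_gt0.
have [m'] := exists_small_step Lgt0 m0; set m := m'.+1.
have mgt0 : 0 < m%:R :> R by rewrite ltr0n.
set h := L / m%:R; rewrite le_min => /andP[hdel hrho].
have h0 : 0 < h by rewrite divr_gt0.
have hcL : h * m%:R = L by rewrite /h; field; rewrite gt_eqF.
have [_ /(_ i eta) HF] := Hdel h m h0 hdel hcL.
have dens : kappa * #|grid d m|%:R <=
    #|[pred k : grid d m | (`|pos h k - y| <= rho)%R]|%:R.
  rewrite /kappa -hcL; apply: grid_density => //.
  by rewrite hcL /L /r; have := normr_ge0 L0; lra.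
have : #|[pred k : grid d m | (`|pos h k - y| <= rho)%R]|%:R * a <=
    kappa * a / 2 * #|grid d m|%:R.
  apply: le_trans HF; rewrite -sum1_card natr_sum mulr_suml.
  rewrite [leRHS](bigID [pred k | (`|pos h k - y| <= rho)%R])/= -[leLHS]addr0.
  apply: lerD; last first.
    by apply: sumr_ge0 => k _; rewrite mulr_ge0// flip_flux_ge0.
  apply: ler_sum => k; rewrite inE => ky.
  have [Kk ak] := Kfl _ ky.
  have -> : in_ball r (pos h k).
    rewrite /in_ball -(subrK y (pos h k)); apply: le_trans (ler_normD _ _) _.
    by rewrite addrC lerD2l.
  rewrite /flip_flux /indic.
  have -> : `[< K (flip i eta) (pos h k) >] = true by exact/asboolP.
  have -> : `[< K eta (pos h k) >] = false.
    by apply/asboolP => K'; apply: noK; exists (pos h k).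
  by rewrite subr0 mulr1 !mul1r.
have G0 := grid_card_gt0 R d m.
have : kappa * #|grid d m|%:R * a <=
    #|[pred k : grid d m | (`|pos h k - y| <= rho)%R]|%:R * a.
  by rewrite ler_pM2r.
have : 0 < kappa * a * #|grid d m|%:R by rewrite !mulr_gt0.
lra.
Qed.

Hypothesis clK : forall eta, closed (K eta).

Lemma closed_hits eta y : (exists2 r, 0 < r & forall rho, 0 < rho -> rho <= r ->
  exists2 z, `|z - y| <= rho & K eta z) -> K eta y.
Proof.
move=> [r r0 H]; apply: clK; apply/closure_norm => e e0.
have [||z zy Kz] := H (Order.min r (e / 2)).
- by rewrite lt_min r0 divr_gt0.
- by rewrite ge_min lexx.
exists z => //; apply: le_lt_trans zy _.
by rewrite gt_min; apply/orP; right; lra.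
Qed.

Lemma interior_back eta x t : 0 <= t ->
  interior (K eta) x -> interior (K eta) (x - t *: vel eta).
Proof.
rewrite le_eqVlt => /predU1P[<-|t0]; first by rewrite scale0r subr0.
move=> /interior_norm[e e0 He]; apply/interior_norm; exists e => // y yx.
apply: closed_hits; exists ((e - `|y - (x - t *: vel eta)|) / 2).
  by rewrite divr_gt0// subr_gt0.
move=> rho rho0 rhor; apply: (back_hits t0) => // z zy; apply: He.
have -> : z - x = (z - (y + t *: vel eta)) + (y - (x - t *: vel eta)).
  by apply/rowP => j; rewrite !mxE; ring.
by apply: le_lt_trans (ler_normD _ _) _; lra.
Qed.

Lemma interior_flip i eta x : uphill U i x eta ->
  interior (K (flip i eta)) x -> interior (K eta) x.
Proof.
move=> up /interior_norm[e e0 He].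
have up2 : vel eta 0 i * partial i U x / 2 < vel eta 0 i * partial i U x.
  by move: up; rewrite /uphill; lra.
have cup : continuous (fun y => vel eta 0 i * partial i U y).
  by move=> y; apply: continuousM; [exact: cst_continuous|exact: cdU].
have [e' e'0 He'] := continuous_gt_near cup up2.
apply/interior_norm; exists (Order.min e e'); first by rewrite lt_min e0.
move=> y; set m := Order.min e e' => yx; apply: closed_hits.
exists ((m - `|y - x|) / 2); first by rewrite divr_gt0// subr_gt0.
move=> rho rho0 rhor.
apply: (@flip_hits i eta y (vel eta 0 i * partial i U x / 2)) => //.
  by rewrite divr_gt0.
move=> z zy.
have : `|z - x| < m.
  have -> : z - x = (z - y) + (y - x) by rewrite addrA subrK.
  by apply: le_lt_trans (ler_normD _ _) _; lra.
by rewrite lt_min => /andP[ze ze']; split; [exact: He|exact/ltW/He'].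
Qed.

End closed_sets.

Record reversible (S : 'rV[bool]_d -> set 'rV[R]_d) : Prop := Reversible {
  reversible_move : forall eta x t, S eta x -> S eta (x + t *: vel eta);
  reversible_flip : forall i eta x, partial i U x != 0 -> S eta x -> S (flip i eta) x }.

Lemma reversible_forward S : reversible S -> forward U S.
Proof.
case=> mv fl; split=> [eta x t _|i eta x t _ Sx up]; first exact: mv.
apply/mv/fl => //; apply: contraTneq up => ->.
by rewrite mulr0 ltxx.
Qed.

Lemma reversibleC S : reversible S -> reversible (fun eta => ~` S eta).
Proof.
case=> mv fl; split=> [eta x t nS Sx|i eta x px nS Sx]; apply: nS.
  by rewrite -(addrK (t *: vel eta) x) -scaleNr; exact: mv.
by rewrite -(flipK i eta); exact: fl.
Qed.

Lemma reversible_interior S : reversible S -> reversible (fun eta => interior (S eta)).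
Proof.
case=> mv fl; split=> [eta x t|i eta x px] /interior_norm[e e0 He]; apply/interior_norm.
  exists e => // y yx; rewrite -(subrK (t *: vel eta) y); apply/mv/He.
  by rewrite -addrA -opprD [_ *: _ + x]addrC.
have [e' e'0 He'] : exists2 e', 0 < e' & forall y, `|y - x| < e' -> 0 < `|partial i U y|.
  apply: (@continuous_gt_near R d (fun y => `|partial i U y|)); last by rewrite normr_gt0.
  by move=> y; apply: continuous_comp; [exact: cdU|exact: norm_continuous].
exists (Order.min e e') => [|y]; first by rewrite lt_min e0.
rewrite lt_min => /andP[ye ye']; apply: fl; last exact: He.
by rewrite -normr_gt0 He'.
Qed.

Lemma closed_forward_interior_reversible K : forward U K -> flip_stable U K ->
  (forall eta, closed (K eta)) -> reversible (fun eta => interior (K eta)).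
Proof.
move=> fK flK clK; split=> [eta x t|i eta x px Kx].
  have [t0|t0] := leP 0 t; last first.
    move=> Kx; rewrite -[t]opprK scaleNr; apply: interior_back => //.
    by rewrite oppr_ge0 ltW.
  move=> /interior_norm[e e0 He]; apply/interior_norm; exists e => // y yx.
  rewrite -(subrK (t *: vel eta) y); apply: (forward_move fK) => //; apply: He.
  by rewrite -addrA -opprD [_ *: _ + x]addrC.
have [up|down] : uphill U i x eta \/ uphill U i x (flip i eta).
  rewrite /uphill velocity_flip eqxx mulNr oppr_gt0.
  apply/orP; rewrite orbC -neq_lt mulf_neq0// -normr_eq0 velocityE normrX normrN1.
  by rewrite expr1n oner_neq0.
- have [e e0 He] := uphill_near cdU up.
  move: Kx => /interior_norm[e' e'0 He']; apply/interior_norm.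
  exists (Order.min e e') => [|y]; first by rewrite lt_min e0.
  by rewrite lt_min => /andP[ye ye']; apply: flK; [exact: He'|exact: He].
- by apply: (interior_flip fK) down _ => //; rewrite flipK.
Qed.

Lemma clopen_line (A : set 'rV[R]_d) x y : open A -> closed A -> A x -> A y.
Proof.
move=> oA cA Ax.
pose l (t : R) := x + t *: (y - x).
have cl : continuous l.
  have cs : continuous (fun t : R => t *: (y - x)) by exact: scalel_continuous.
  by move=> t; exact: (continuousD (@cst_continuous _ _ x t) (@cs t)).
have cR : connected [set: R] by exact/connected_intervalP.
have E : l @^-1` A = setT.
  apply: cR.
  - by exists 0; rewrite /= /l scale0r addr0.
  - by exists (l @^-1` A); [apply: open_comp => // ? _; exact: cl|rewrite setTI].
  - by exists (l @^-1` A); [apply: closed_comp => // ? _; exact: cl|rewrite setTI].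
have : (l @^-1` A) 1 by rewrite E.
by rewrite /= /l scale1r addrCA subrr addr0.
Qed.

(** Let [N] be the interior of the complement of [J]. The set of phases in
    neither of them is stable under the same moves and has empty interior, so
    it is empty by [forward_interior]; each section of [J] is then clopen. Passing
    from one velocity to another only takes a point where a partial derivative
    does not vanish. *)
Lemma reversible_open_full J eta0 x0 : reversible J -> (forall eta, open (J eta)) ->
  J eta0 x0 -> forall eta x, J eta x.
Proof.
move=> rJ oJ Jx0.
pose N eta := interior (~` J eta).
have rN : reversible N by exact/reversible_interior/reversibleC.
have JN eta x : J eta x \/ N eta x.
  apply: contrapT => nJN.
  have rB : reversible (fun eta => ~` (J eta `|` N eta)).
    apply: reversibleC; split=> [e z t [Jz|Nz]|i e z pz [Jz|Nz]].
    - by left; exact: reversible_move.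
    - by right; exact: reversible_move.
    - by left; exact: reversible_flip.
    - by right; exact: reversible_flip.
  have [e [z Bz]] := forward_interior dU cdU cU coU (reversible_forward rB) nJN.
  have := interior_subset Bz; apply; right.
  by apply: interiorS Bz => w nw Jw; apply: nw; left.
have full eta x : J eta x -> forall y, J eta y.
  move=> Jx y; apply: (@clopen_line (J eta) x y) => //.
  rewrite -[J eta]setCK; apply: open_closedC.
  rewrite (_ : ~` J eta = N eta); first exact: open_interior.
  apply/seteqP; split => [z nJ|]; last exact: interior_subset.
  by have [] := JN eta z.
suff H (s : seq 'I_d) eta : (forall j, j \notin s -> eta 0 j = eta0 0 j) ->
    forall x, J eta x.
  by move=> eta; apply: (H (enum 'I_d)) => j; rewrite mem_enum.
elim: s eta => [|i s IH] eta Heta.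
  have -> : eta = eta0 by apply/rowP => j; exact: Heta.
  exact: full Jx0.
(* The whole phase space is forward, hence [d_i U] does not vanish identically. *)
have [eta1 [x1 [_ up]]] := exists_uphill dU cdU cU coU
  (reversible_forward (@Reversible (fun=> setT) (fun _ _ _ _ => I) (fun _ _ _ _ _ => I)))
  i (I : (fun=> setT) eta0 x0).
have px1 : partial i U x1 != 0.
  by apply: contraTneq up => px; rewrite /uphill px mulr0 ltxx.
have [e|ne] := eqVneq (eta 0 i) (eta0 0 i).
  apply: IH => j js; have [->//|ji] := eqVneq j i.
  by apply: Heta; rewrite inE negb_or ji.
apply: (full eta x1); rewrite -(flipK i eta); apply: (reversible_flip rJ) => //.
apply: IH => j js; rewrite mxE; case: eqP => [->|/eqP ji].
  by move: ne; case: (eta 0 i); case: (eta0 0 i).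
by apply: Heta; rewrite inE negb_or ji.
Qed.

(** The closure of [S] is a closed forward set, so its interior is nonempty,
    open and reversible. *)
Lemma closure_forward_full S eta0 x0 : forward U S -> S eta0 x0 ->
  forall eta x, closure (S eta) x.
Proof.
move=> fS Sx0.
have fK := forward_closed_hull cdU fS.
have flK := closed_hull_flip cdU fS.
have clK eta : closed (closed_hull S eta) by exact: closed_closure.
have [eta1 [x1 Kx1]] := forward_interior dU cdU cU coU fK (subset_closure Sx0).
move=> eta x; apply: interior_subset.
apply: (reversible_open_full (closed_forward_interior_reversible fK flK clK) _ Kx1).
by move=> ?; exact: open_interior.
Qed.

End reversibility.

(** * Reachability and control sequences *)

Section step_integral.
Context (R : realType).
Notation mu := (@lebesgue_measure R).

Lemma Rintegral_step (f : R -> R) (p v : nat -> R) (m : nat) :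
  (forall s, `|f s| <= 1) ->
  {homo p : j k / (j <= k)%N >-> j <= k} ->
  (forall j s, (j < m)%N -> p j <= s < p j.+1 -> f s = v j) ->
  mu.-integrable `[p 0%N, p m[ (EFin \o f) /\
  \int[mu]_(s in `[p 0%N, p m[) f s = \sum_(j < m) v j * (p j.+1 - p j).
Proof.
move=> f1 homo_p; have bounded_integrable (a b : R) : measurable_fun `[a, b[ f ->
    mu.-integrable `[a, b[ (EFin \o f).
  move=> mf; apply: measurable_bounded_integrable => //.
    by rewrite /= lebesgue_measure_itv/=; case: ifP => _; rewrite ?ltry// -EFinB ltry.
  by exists 1; split; [exact: num_real|move=> M /ltW M1 s _ /=; exact: le_trans M1].
suff : (forall j s, (j < m)%N -> p j <= s < p j.+1 -> f s = v j) ->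
  measurable_fun `[p 0%N, p m[ f /\
  \int[mu]_(s in `[p 0%N, p m[) f s = \sum_(j < m) v j * (p j.+1 - p j).
  by move=> H /H[mf ->]; split => //; exact: bounded_integrable.
elim: m => [_|m IH fv].
  by rewrite set_itvco0 Rintegral_set0 big_ord0; split => //; exact: measurable_fun_set0.
have [mf E] := IH (fun j s jm => fv j s (ltnW jm)).
have pm : p m <= p m.+1 by exact: homo_p.
have p0m : p 0%N <= p m by exact: homo_p.
have mfm : measurable_fun `[p m, p m.+1[ f.
  apply: (@eq_measurable_fun _ _ _ _ _ (cst (v m))); last exact: measurable_cst.
  by move=> s; rewrite inE /= in_itv /= => /(fv m s (ltnSn m)).
have U : `[p 0%N, p m.+1[%classic = `[p 0%N, p m[ `|` `[p m, p m.+1[ :> set R.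
  by rewrite -itv_bndbnd_setU.
have mfU : measurable_fun `[p 0%N, p m.+1[ f.
  by rewrite U; apply/measurable_funU.
split => //; rewrite U Rintegral_setU//.
- rewrite E big_ord_recr /=; congr (_ + _).
  rewrite (@eq_Rintegral _ _ _ mu _ (cst (v m))); last first.
    by move=> s; rewrite inE /= in_itv /= => /(fv m s (ltnSn m)).
  rewrite Rintegral_cst//= lebesgue_measure_itv/= lte_fin.
  by move: pm; rewrite le_eqVlt => /predU1P[->|->] /=; rewrite ?ltxx ?subrr.
- by rewrite -U; exact: bounded_integrable.
- apply/disj_setPS => s [] /=; rewrite !in_itv /= => /andP[_ H1] /andP[H2 _].
  by move: H1; rewrite ltNge H2.
Qed.

End step_integral.

Section controls.
Context (R : realType) (d : nat).
Local Notation vel := (@velocity R d).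
Implicit Types (u : control R d) (eta : 'rV[bool]_d) (x : 'rV[R]_d).

Definition waypoint (ts : seq R) (I : seq 'I_d) eta x (k : nat) : 'rV[R]_d :=
  x + \sum_(j < k) ts`_j *: vel (flips (take j I) eta).

Lemma waypointS ts I eta x k : waypoint ts I eta x k.+1 =
  waypoint ts I eta x k + ts`_k *: vel (flips (take k I) eta).
Proof. by rewrite /waypoint big_ord_recr addrA. Qed.

Lemma tau_homo u : {homo tau u : j k / (j <= k)%N >-> j <= k}.
Proof.
apply: homo_leq => [//|? ? ?|k]; first exact: le_trans.
rewrite /tau big_ord_recr lerDl /=.
have [km|km] := ltnP k (size (durations u)); last by rewrite nth_default.
have km' : (k < (nb_flips u).+1)%N by rewrite -[X in (_ < X)%N](size_tuple (durations u)).
by have := @durations_gt0 _ _ u (Ordinal km'); rewrite (tnth_nth 0) => /ltW.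
Qed.

Lemma traj_thetaE u eta j s : (j <= nb_flips u)%N -> tau u j <= s < tau u j.+1 ->
  traj_theta u eta s = flips (take j (flipped u)) eta.
Proof.
move=> jm /andP[js sj]; rewrite /traj_theta; congr (flips (take _ _) _).
rewrite -[in iota _ _](subnKC jm) iotaD count_cat.
rewrite (eq_in_count (a2 := predT)); last first.
  move=> k; rewrite mem_iota add1n ltnS => /andP[_ kj] /=.
  by apply: le_trans js; exact: tau_homo.
rewrite count_predT size_iota (eq_in_count (a2 := pred0)) ?count_pred0 ?addn0//.
move=> k; rewrite mem_iota add1n => /andP[jk _] /=.
by apply/negbTE; rewrite -ltNge; apply: lt_le_trans sj _; exact: tau_homo.
Qed.

Lemma traj_x_tau u eta x k : (k <= (nb_flips u).+1)%N ->
  traj_x u x eta (tau u k) = waypoint (durations u) (flipped u) eta x k.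
Proof.
move=> km; rewrite /traj_x /waypoint; congr (_ + _); apply/rowP => i.
rewrite !mxE summxE.
have [||itf E] := @Rintegral_step R (fun s => vel (traj_theta u eta s) 0 i) (tau u)
  (fun j => vel (flips (take j (flipped u)) eta) 0 i) k _ (@tau_homo u).
- by move=> s; rewrite velocityE normrX normrN1 expr1n.
- by move=> j s jk js; rewrite (@traj_thetaE _ _ j)//; exact: leq_trans jk km.
have tau0 : tau u 0 = 0 by rewrite /tau big_ord0.
rewrite tau0 in itf E.
rewrite -(Rintegral_itv_bndo_bndc itf) E; apply: eq_bigr => j _.
by rewrite [RHS]mxE mulrC /tau big_ord_recr /= addrAC subrr add0r.
Qed.

End controls.

Section reachability.
Context (R : realType) (d : nat) (U : 'rV[R]_d -> R).
Local Notation vel := (@velocity R d).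
Implicit Types (z w : phase R d) (eta : 'rV[bool]_d) (x : 'rV[R]_d) (t : R).

Inductive reach z : phase R d -> Prop :=
| reach_move t : 0 < t -> reach z (z.1 + t *: vel z.2, z.2)
| reach_flip w i t : reach z w -> uphill U i w.1 w.2 -> 0 < t ->
    reach z (w.1 + t *: vel (flip i w.2), flip i w.2).

Lemma reach_extend z w t : 0 <= t -> reach z w -> reach z (w.1 + t *: vel w.2, w.2).
Proof.
move=> t0 [s s0|w' i s zw' up s0] /=; rewrite -addrA -scalerDl.
  by apply: reach_move; rewrite ltr_wpDr.
by apply: reach_flip => //; rewrite ltr_wpDr.
Qed.

Lemma reach_trans z w w' : reach z w -> reach w w' -> reach z w'.
Proof.
move=> zw; elim=> [t t0|v i t _ zv up t0]; last exact: reach_flip.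
by apply: reach_extend => //; exact: ltW.
Qed.

(** Reversing time turns the last piece of a path into the first one, so paths
    have to be extended at their beginning too. *)
Lemma reach_flip_first x eta i t w : 0 < t -> uphill U i (x + t *: vel eta) eta ->
  reach (x + t *: vel eta, flip i eta) w -> reach (x, eta) w.
Proof.
move=> t0 up; elim=> [s s0|v j s _ zv upv s0]; last exact: reach_flip.
by apply: (reach_flip (reach_move (x, eta) t0)).
Qed.

Definition turn z : phase R d := (z.1, reverse z.2).

Lemma turnK : involutive turn.
Proof. by case=> x eta; rewrite /turn /= reverseK. Qed.

(** Component [i] of the velocity has the same sign before an uphill flip and,
    on the reversed path, before the corresponding flip: the reversed path
    comes to it with the velocity [reverse (flip i eta)]. *)
Lemma reach_turn z w : reach z w -> reach (turn w) (turn z).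
Proof.
elim=> [t t0|v i t _ IH up t0]; rewrite /turn /=.
  have := reach_move (z.1 + t *: vel z.2, reverse z.2) t0.
  by rewrite /= velocity_reverse scalerN addrK.
have E : v.1 + t *: vel (flip i v.2) + t *: vel (reverse (flip i v.2)) = v.1.
  by rewrite velocity_reverse scalerN addrK.
apply: (@reach_flip_first _ _ i t) => //; rewrite E.
  exact/uphill_reverse.
by rewrite -reverse_flip flipK.
Qed.

Lemma reach_forward z : forward U (fun eta => [set x | reach z (x, eta)]).
Proof.
split=> [eta x t t0 zx|i eta x t t0 zx up]; first exact: (reach_extend t0 zx).
exact: (reach_flip zx up t0).
Qed.

Lemma reach_waypoints z w : reach z w -> exists ts I,
  [/\ size ts = (size I).+1, all (fun t => 0 < t) ts,
    forall i0 k, (k < size I)%N ->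
      uphill U (nth i0 I k) (waypoint ts I z.2 z.1 k.+1) (flips (take k I) z.2) &
    w = (waypoint ts I z.2 z.1 (size I).+1, flips I z.2)].
Proof.
elim=> [t t0|v i t _ [ts [I [szts ts0 upI ->]]] up t0].
  exists [:: t], [::]; split => //=; first by rewrite t0.
  by rewrite /waypoint big_ord_recr big_ord0 /= add0r.
have flips_rcons eta : flips (rcons I i) eta = flip i (flips I eta).
  rewrite /flips foldr_rcons; elim: I {szts upI up} => //= j I ->.
  by apply/rowP => k; rewrite !mxE; do 2 case: eqP.
have waypointE k : (k <= (size I).+1)%N ->
    waypoint (rcons ts t) (rcons I i) z.2 z.1 k = waypoint ts I z.2 z.1 k.
  move=> kI; congr (_ + _); apply: eq_bigr => j _.
  have jI : (j < (size I).+1)%N by exact: leq_trans kI.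
  by rewrite nth_rcons szts jI -cats1 takel_cat.
exists (rcons ts t), (rcons I i); split.
- by rewrite !size_rcons szts.
- by rewrite all_rcons t0.
- move=> i0 k; rewrite size_rcons ltnS leq_eqVlt => /predU1P[->|kI].
    by rewrite nth_rcons ltnn eqxx waypointE// -cats1 take_size_cat.
  have kI' := ltnW kI.
  rewrite nth_rcons kI waypointE// (_ : take k _ = take k I); first exact: upI.
  by rewrite -cats1 takel_cat.
rewrite size_rcons flips_rcons; congr (_, _).
rewrite [RHS]waypointS waypointE//=.
by rewrite nth_rcons szts ltnn eqxx -[(size I).+1](size_rcons I i) take_size flips_rcons.
Qed.

Variable lambda : 'I_d -> phase R d -> R.
Hypothesis lambdaU : switching_intensities U lambda.

Lemma uphill_intensity_gt0 i x eta : uphill U i x eta -> 0 < lambda i (x, eta).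
Proof.
have [_ ge0 eqU] := lambdaU i; rewrite /uphill -eqU => up.
by have := ge0 (x, flip i eta); lra.
Qed.

Lemma reach_leadsto z w : reach z w -> leadsto lambda z w.
Proof.
move=> /reach_waypoints[ts [I [/eqP szts ts0 upI ->]]].
have ts_gt0 k : 0 < tnth (Tuple szts) k.
  by move/all_tnthP : (ts0 : all _ (Tuple szts)); apply.
pose u := @Control R d (size I) (Tuple szts) (in_tuple I) ts_gt0.
exists u; split=> [k|].
  rewrite traj_x_tau; last by rewrite ltnS ltnW.
  apply: uphill_intensity_gt0; rewrite (tnth_nth (tnth (in_tuple I) k)) /=.
  exact: upI.
by rewrite /endpoint traj_x_tau.
Qed.

End reachability.

Theorem theorem4 (R : realType) (d : nat) (U : 'rV[R]_d -> R)
    (lambda : 'I_d -> phase R d -> R) :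
  (0 < d)%N ->
  class_C 3 U ->
  integrable_exp U ->
  coercive U ->
  (exists x, nondegenerate_local_min U x) ->
  switching_intensities U lambda ->
  (exists C : set (phase R d), range (commclass lambda) = [set C]) /\
  (forall z z' : phase R d, leadsto lambda z z').
Proof.
move=> _ [cU C1] _ coU _ lambdaU.
have dU i x : derivable U x 'e_i by have [] := C1 i.
have cdU i : continuous (partial i U) by have [_ []] := C1 i.
have leads z z' : leadsto lambda z z'.
  apply: (reach_leadsto lambdaU).
  pose S w eta := [set x | reach U w (x, eta)].
  have S0 w : S w w.2 (w.1 + 1 *: velocity R w.2) by exact: reach_move.
  have [eta [x /interior_norm[e e0 He]]] := forward_interior dU cdU cU coU
    (@reach_forward _ _ U (turn z')) (S0 (turn z')).
  have /closure_norm/(_ e e0)[y zy yx] : closure (S z (reverse eta)) x.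
    exact: (closure_forward_full dU cdU cU coU (@reach_forward _ _ U z) (S0 z)).
  apply: (reach_trans zy); rewrite -[z']turnK -[(y, _)]turnK.
  by apply: reach_turn; rewrite /turn /= reverseK; exact: He.
split => //; exists setT.
have classT z : commclass lambda z = setT.
  by apply/seteqP; split => // z' _; right.
apply/seteqP; split => [_ [z _ <-]|_ ->]; first exact: classT.
by exists (0, \row_i false).
Qed.
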